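(* Let $0\le\alpha\in L^1([0,\infty))$, $0\le\sigma\in L^1_{\rm loc}([0,\infty))$, and $\beta(t):=\alpha(t)\exp\left(-\int_0^t\sigma(s)ds\right)$. Let $\rho_\pm>0$ and $u_\pm$ be constants and suppose $u_->u_+$. For $\varepsilon>0$ let $(\rho^\varepsilon,u^\varepsilon)$ be the solution of the problem $$\rho^\varepsilon_t+\alpha(t)(\rho^\varepsilon u^\varepsilon)_x=\varepsilon\beta(t)\rho^\varepsilon_{xx},\qquad u^\varepsilon_t+\tfrac12\alpha(t)\left((u^\varepsilon)^2\right)_x+\sigma(t)u^\varepsilon=\varepsilon\beta(t)u^\varepsilon_{xx},$$ with initial data $(\rho^\varepsilon,u^\varepsilon)(x,0)=(\rho_-,u_-)$ for $x<0$ and $(\rho_+,u_+)$ for $x>0$. Then the limit $$\lim_{\varepsilon\to0^+}(\rho^\varepsilon(x,t),u^\varepsilon(x,t))=(\rho(x,t),u(x,t))$$ exists in the sense of distributions, and $(\rho(x,t),u(x,t))$ solves (as a delta shock wave solution) the problem $$\rho_t+\alpha(t)(\rho u)_x=0,\qquad u_t+\alpha(t)\left(\tfrac{u^2}{2}\right)_x=-\sigma(t)u$$ with initial data $(\rho_-,u_-)$ for $x<0$ and $(\rho_+,u_+)$ for $x>0$. In addition, $$(\rho(x,t),u(x,t))=\begin{cases}\left(\rho_-,\,u_-\exp(-\int_0^t\sigma(s)ds)\right),& x<x(t),\\ \left(w(t)\,\delta(x-x(t)),\,\frac{u_-+u_+}{2}\exp(-\int_0^t\sigma(s)ds)\right),&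 x=x(t),\\ \left(\rho_+,\,u_+\exp(-\int_0^t\sigma(s)ds)\right),& x>x(t),\end{cases}$$ where $$w(t)=\tfrac12(\rho_-+\rho_+)(u_--u_+)\int_0^t\alpha(s)\exp\left(-\int_0^s\sigma(\tau)d\tau\right)ds,\qquad x(t)=\frac{u_-+u_+}{2}\int_0^t\alpha(s)\exp\left(-\int_0^s\sigma(\tau)d\tau\right)ds.$$
   Context: Here $x\in\mathbb{R}$ and $t>0$. The solution $(\rho^\varepsilon,u^\varepsilon)$ of the viscous problem is the explicit one: $\rho^\varepsilon=\partial_xW^\varepsilon$ and $u^\varepsilon=\frac{u_+b^\varepsilon_++u_-b^\varepsilon_-}{b^\varepsilon_++b^\varepsilon_-}\exp(-\int_0^t\sigma(s)ds)$, where, with $B(t)=\int_0^t\beta(s)ds$, $$b^\varepsilon_\pm(x,t)=\pm\frac{1}{(4\pi\varepsilon B(t))^{1/2}}\int_0^{\pm\infty}\exp\left(-\frac{(x-y)^2}{4\varepsilon B(t)}-\frac{u_\pm y}{2\varepsilon}\right)dy,$$ $$W^\varepsilon(x,t)=\frac{\rho_-(x-u_-B(t))b^\varepsilon_-+\rho_+(x-u_+B(t))b^\varepsilon_+}{b^\varepsilon_-+b^\varepsilon_+}+(\rho_+-\rho_-)\frac{(\varepsilon B(t))^{1/2}\exp\left(-\frac{x^2}{4\varepsilon B(t)}\right)}{\pi^{1/2}(b^\varepsilon_-+b^\varepsilon_+)}.$$ Weighted delta function: given $w\in L^1((a,b))$, $-\infty<a<b<\infty$, and a smooth curve $L=\{(x(s),t(s)):a<s<b\}$,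 $w(\cdot)\delta_L$ is the two-dimensional weighted delta function supported on $L$ when, for each test function $\varphi\in C_0^\infty(\mathbb{R}\times[0,\infty))$, $\langle w(\cdot)\delta_L,\varphi\rangle=\int_a^bw(s)\varphi(x(s),t(s))\,ds$. The entry $w(t)\delta(x-x(t))$ on $x=x(t)$ denotes the singular part $w\delta_L$ of $\rho$, supported on the curve $x=x(t)$. Delta shock wave solution: a distribution pair $(\rho,u)$ for which there exist a smooth curve $L$ and a function $w(\cdot)$ such that $\rho=\widehat\rho(x,t)+w\delta_L$, $u=u(x,t)$, with $\widehat\rho,u\in L^\infty(\mathbb{R}\times(0,\infty))$, $u|_L=u_\delta(\cdot)$, and for each $\varphi\in C_0^\infty(\mathbb{R}\times(0,\infty))$ $$\langle\rho,\varphi_t\rangle+\langle\alpha\rho u,\varphi_x\rangle=0,\qquad \iint_{\mathbb{R}\times(0,\infty)}\left(u\varphi_t+\tfrac{\alpha(t)}{2}u^2\varphi_x-\sigma(t)u\varphi\right)dx\,dt=0,$$ where $\langle\rho,\varphi\rangle=\iint\widehat\rho\,\varphi\,dx\,dt+\langle w\delta_L,\varphi\rangle$ and $\langle\alpha\rho u,\varphi\rangle=\iint\alpha(t)\widehat\rho\,u\,\varphi\,dx\,dt+\langle\alpha(\cdot)wu_\delta\delta_L,\varphi\rangle$, the double integrals being over $\mathbb{R}\times(0,\infty)$.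
   Formalization: The curve L need only be locally absolutely continuous, not smooth (x(t) need not be smooth for α merely in L¹); its parameter interval may be unbounded, with w integrable on compact parts; where B(t)=0 the viscous solution is the initial datum (u damped). *)

(* Defs.v *)
From HB Require Import structures.
From mathcomp Require Import all_boot all_order all_algebra.
From mathcomp Require Import all_classical all_reals all_analysis.

Set Implicit Arguments.
Unset Strict Implicit.
Unset Printing Implicit Defensive.

Import Order.TTheory GRing.Theory Num.Theory.
Import numFieldNormedType.Exports.

Local Open Scope classical_set_scope.
Local Open Scope ring_scope.

Section plane.
Context {R : realType}.
Implicit Types (f phi : R * R -> R) (F : (R * R -> R) -> R).

(* Points of the plane are pairs (x, t). *)
Definition leb2 := (@lebesgue_measure R \x @lebesgue_measure R)%E.

Definition upper : set (R * R) := [set p | 0 < p.2].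
Definition upper_closed : set (R * R) := [set p | 0 <= p.2].

Definition dx phi : R * R -> R := fun p => 'D_(1, 0) phi p.
Definition dt phi : R * R -> R := fun p => 'D_(0, 1) phi p.

Fixpoint Ck (n : nat) phi : Prop :=
  if n is m.+1 then
    [/\ continuous phi,
        forall p, derivable phi p (1, 0), forall p, derivable phi p (0, 1),
        Ck m (dx phi) & Ck m (dt phi)]
  else continuous phi.

Definition smooth phi := forall n, Ck n phi.

Definition supp phi : set (R * R) := closure [set p | phi p != 0].

(* C_0^oo(R x (0, oo)). *)
Definition test_open phi :=
  [/\ smooth phi, compact (supp phi) & supp phi `<=` upper].

(* C_0^oo(R x [0, oo)): its elements are the restrictions to t >= 0 of the
   functions below; only their values for t >= 0 are ever used. *)
Definition test_closed phi := smooth phi /\ compact (supp phi).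

Definition int_upper f : R := \int[leb2]_(p in upper) f p.

Definition locally_integrable2 f := forall K, compact K -> K `<=` upper ->
  leb2.-integrable K (EFin \o f).

Definition Linfty_upper f :=
  measurable_fun upper f /\ finite_norm leb2 +oo%E (f \_ upper).

Definition regular_distr f : (R * R -> R) -> R :=
  fun phi => int_upper (f \* phi).

Definition cvg_distr (f_ : R -> R * R -> R) F :=
  (forall eps, 0 < eps -> locally_integrable2 (f_ eps)) /\
  (forall phi, test_open phi ->
     regular_distr (f_ eps) phi @[eps --> 0^'+] --> F phi).

End plane.

Section coefficients.
Context {R : realType}.
Local Notation leb := (@lebesgue_measure R).

(* L^1_loc([0, oo)), compactness being relative to the half-line closed at 0. *)
Definition L1_loc (f : R -> R) := forall K : set R, compact K ->
  K `<=` `[0, +oo[ ->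
  leb.-integrable K (EFin \o f).

Definition damping (sigma : R -> R) (t : R) : R :=
  expR (- \int[leb]_(s in `[0, t]) sigma s).

Definition beta (alpha sigma : R -> R) (t : R) : R :=
  alpha t * damping sigma t.

Definition Bint (alpha sigma : R -> R) (t : R) : R :=
  \int[leb]_(s in `[0, t]) beta alpha sigma s.

Definition riemann (l r x : R) : R := if x < 0 then l else r.

End coefficients.

Section viscous.
Context {R : realType}.
Variables (alpha sigma : R -> R) (rhom rhop um up : R) (eps : R).
Local Notation leb := (@lebesgue_measure R).
Local Notation B := (Bint alpha sigma).

Definition heat_integrand (v x t y : R) : R :=
  expR (- ((x - y) ^+ 2 / (4 * eps * B t)) - v * y / (2 * eps)).

Definition bplus (x t : R) : R := (Num.sqrt (4 * pi * eps * B t))^-1 *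
  \int[leb]_(y in `[0, +oo[) heat_integrand up x t y.

Definition bminus (x t : R) : R := (Num.sqrt (4 * pi * eps * B t))^-1 *
  \int[leb]_(y in `]-oo, 0]) heat_integrand um x t y.

Definition Wvisc (x t : R) : R :=
  (rhom * (x - um * B t) * bminus x t + rhop * (x - up * B t) * bplus x t)
    / (bminus x t + bplus x t)
  + (rhop - rhom) *
    (Num.sqrt (eps * B t) * expR (- (x ^+ 2 / (4 * eps * B t))))
    / (Num.sqrt pi * (bminus x t + bplus x t)).

(* The closed formulas make sense only where B t > 0.  If alpha vanishes almost
   everywhere on (0, t), then B t = 0, flux and viscosity are absent up to time
   t, and the solution is the (damped) initial datum, which is also the limit of
   the closed formulas at x != 0 as B tends to 0. *)
Definition rho_visc (p : R * R) : R :=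
  if B p.2 == 0 then riemann rhom rhop p.1
  else derive1 (fun x => Wvisc x p.2) p.1.

Definition u_visc (p : R * R) : R :=
  let: (x, t) := p in
  (if B t == 0 then riemann um up x
   else (up * bplus x t + um * bminus x t) / (bplus x t + bminus x t))
  * damping sigma t.

End viscous.

Section delta_shock.
Context {R : realType}.
Local Notation leb := (@lebesgue_measure R).

(* The curve is {(X s, T s) : s in I}.  Its coordinates are only required to be
   locally absolutely continuous, i.e. to be primitives of locally integrable
   functions: with alpha merely integrable, the shock x = x(t) is in general
   not differentiable everywhere. *)
Definition locally_AC (I : interval R) (f : R -> R) :=
  exists g : R -> R, forall a b, a \in I -> b \in I -> a <= b ->
    leb.-integrable `[a, b] (EFin \o g) /\
    f b - f a = \int[leb]_(s in `[a, b]) g s.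

Definition weighted_delta (I : interval R) (X T w : R -> R)
    (phi : R * R -> R) : R :=
  \int[leb]_(s in [set` I]) (w s * phi (X s, T s)).

(* For a bounded I, w in L^1(I) implies this; it is what makes weighted_delta
   meaningful when I is unbounded, as for the curve x = x(t), t > 0. *)
Definition integrable_along (I : interval R) (X T w : R -> R) :=
  forall K : set (R * R), compact K -> K `<=` upper_closed ->
    leb.-integrable ([set` I] `&` [set s | K (X s, T s)]) (EFin \o w).

Record shock_data := ShockData {
  sh_I : interval R;
  sh_X : R -> R;
  sh_T : R -> R;
  sh_w : R -> R;
  sh_rho : R * R -> R;
  sh_u : R * R -> R;
  sh_udelta : R -> R }.

Variables (alpha sigma : R -> R).

Definition flux_weight (D : shock_data) (s : R) : R :=
  alpha (sh_T D s) * sh_w D s * sh_udelta D s.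

Definition shock_data_wf (D : shock_data) : Prop :=
  [/\ [set` sh_I D] !=set0 /\ open [set` sh_I D],
      locally_AC (sh_I D) (sh_X D) /\ locally_AC (sh_I D) (sh_T D),
      integrable_along (sh_I D) (sh_X D) (sh_T D) (sh_w D) /\
      integrable_along (sh_I D) (sh_X D) (sh_T D) (flux_weight D),
      Linfty_upper (sh_rho D) /\ Linfty_upper (sh_u D) &
      forall s, s \in sh_I D ->
        0 <= sh_T D s /\ sh_u D (sh_X D s, sh_T D s) = sh_udelta D s].

Definition pair_rho (D : shock_data) (phi : R * R -> R) : R :=
  int_upper (sh_rho D \* phi) +
  weighted_delta (sh_I D) (sh_X D) (sh_T D) (sh_w D) phi.

Definition pair_flux (D : shock_data) (phi : R * R -> R) : R :=
  int_upper (fun p => alpha p.2 * sh_rho D p * sh_u D p * phi p) +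
  weighted_delta (sh_I D) (sh_X D) (sh_T D) (flux_weight D) phi.

Definition u_balance (u phi : R * R -> R) : R :=
  int_upper (fun p => u p * dt phi p + alpha p.2 / 2 * u p ^+ 2 * dx phi p
                      - sigma p.2 * u p * phi p).

Definition weak_equations (D : shock_data) : Prop :=
  forall phi, test_open phi ->
    pair_rho D (dt phi) + pair_flux D (dx phi) = 0 /\
    u_balance (sh_u D) phi = 0.

(* The initial values enter through test functions that need not vanish at
   t = 0, as the boundary term of the integration by parts in t. *)
Definition attains_initial_data (D : shock_data) (rho0 u0 : R -> R) : Prop :=
  forall phi, test_closed phi ->
    pair_rho D (dt phi) + pair_flux D (dx phi)
      + \int[leb]_(x in setT) (rho0 x * phi (x, 0)) = 0 /\
    u_balance (sh_u D) phi + \int[leb]_(x in setT) (u0 x * phi (x, 0)) = 0.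

Definition delta_shock_wave_solution (rho0 u0 : R -> R)
    (rho : (R * R -> R) -> R) (u : R * R -> R) : Prop :=
  exists D : shock_data,
    [/\ shock_data_wf D,
        (forall phi, test_closed phi -> rho phi = pair_rho D phi) /\
        (forall p, upper p -> u p = sh_u D p),
        weak_equations D &
        attains_initial_data D rho0 u0].

End delta_shock.

Section profile.
Context {R : realType}.
Variables (alpha sigma : R -> R) (rhom rhop um up : R).

Definition shock_position (t : R) : R := (um + up) / 2 * Bint alpha sigma t.

Definition shock_weight (t : R) : R :=
  (rhom + rhop) * (um - up) / 2 * Bint alpha sigma t.

(* The value l to the left of x = x(t), m on it and r to its right. *)
Definition three_states (l m r : R) (p : R * R) : R :=
  if p.1 < shock_position p.2 then l
  else if p.1 == shock_position p.2 then m else r.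

End profile.

(* Main.v *)
Require Import Defs.
From HB Require Import structures.
From mathcomp Require Import all_boot all_order all_algebra.
From mathcomp Require Import all_classical all_reals all_analysis.
From mathcomp Require Import measurable_realfun ess_sup_inf ring lra.

Import Order.TTheory GRing.Theory Num.Theory.
Import numFieldNormedType.Exports.

Local Open Scope classical_set_scope.
Local Open Scope ring_scope.

(** Everything depends on [t] through [B t], the primitive of [beta], apart from
    the factor [damping].  The shock is [x = X t] with
    [X = (um + up) / 2 * B], and its weight [w] is also a multiple of [B].

    Viscous side.  Completing the square turns [bminus] and [bplus] into one and
    the same factor times [mills zleft] and [mills zright], where
    [mills z = exp (z^2) * int_(s <= z) exp (- s^2)],
    [zright = (x - up * B) / k], [zleft = - (x - um * B) / k] and
    [k = sqrt (4 * eps * B)].  Hence the viscous velocity is the mean of [um] and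
    [up] with the weights [pleft] and [pright], which add up to [1], and
    [Wvisc] is up to an error [O(sqrt eps)] the mean of [rhom * (x - um * B)] and
    [rhop * (x - up * B)] with the same weights.  Since [up < um], the sum
    [zleft + zright] is nonnegative, so one of the two is, and the denominator
    [mills zleft + mills zright] stays away from [0].  Moreover
    [zright^2 - zleft^2 = (x - X t) * (um - up) / (2 * eps)]: on each side of the
    shock the weight that belongs to the other side is exponentially small, and
    the cruder bounds [pleft_decay] and [pright_decay] by a multiple of [eps]
    are enough to conclude that [u_visc] and [Wvisc] converge off the shock.

    For the velocity dominated convergence finishes the proof.  The density is
    not bounded uniformly in [eps], but it is the [x]-derivative of the
    potential [Wvisc], which is bounded on bounded sets.  So the derivative is
    moved to the test function ([viscous_parts]), dominated convergence applies
    to the potentials, and the derivative is moved back in the limit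
    ([limit_parts]): the limit potential jumps by
    [rhop * (X t - up * B t) - rhom * (X t - um * B t) = w t] across the shock,
    and this is the delta part of the limit density.

    Limit side.  The coefficients are merely integrable, so the shock curve and
    the weight are absolutely continuous but need not be differentiable, and no
    pointwise form of the equations is available.  The shear
    [(y, t) |-> (y + X t, t)] preserves the area ([int_upper_shear]) and turns
    the three states into functions of [y] alone.  By Fubini's theorem what
    remains are integrals of total derivatives of the test function along
    translates of the curve; these are evaluated by [transport_along_curve] and
    produce the initial data.  There is left over the flux relative to the moving
    frame, constant on each side up to a factor that depends on [t] only, and its
    contribution is its jump on the curve.  For the velocity,
    [u^2 / 2 - (um + up) / 2 * u] takes the same value at [um] and at [up], which
    is the Rankine-Hugoniot condition.  For the mass the jump does not vanish
    ([int_upper_mass]): it is the rate at which mass enters the shock, that is,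
    the derivative of [w], and the delta part compensates it
    ([weighted_delta_mass]). *)

Set Implicit Arguments.
Unset Strict Implicit.
Unset Printing Implicit Defensive.

(** * Measurability, integrability and derivatives *)

Section plane_measurability.
Context {R : realType}.
Implicit Types (A D : set (R * R)) (f : R * R -> R).

(** The measurable sets of the plane form the product of two Borel algebras, to
    which an open set belongs as a countable union of boxes with rational end
    points. *)
Lemma open_measurable2 A : open A -> measurable A.
Proof.
move=> oA.
pose box (q : rat * rat * (rat * rat)) : set (R * R) :=
  `]ratr q.1.1, ratr q.1.2[%classic `*` `]ratr q.2.1, ratr q.2.2[%classic.
pose Q := [set q | box q `<=` A].
have -> : A = \bigcup_(q in Q) box q.
  apply/seteqP; split=> [[x y] Axy|p [q qQ /qQ//]].
  have : nbhs (x, y) A by exact: open_nbhs_nbhs.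
  move=> [[U V]/= [/nbhs_ballP[e/= e0 eU] /nbhs_ballP[d/= d0 dV]] UVA].
  have lt2 (z r : R) : 0 < r -> z - r < z < z + r by move=> ?; lra.
  have /andP[/rat_in_itvoo[q1 q1P] /rat_in_itvoo[q2 q2P]] := lt2 x e e0.
  have /andP[/rat_in_itvoo[q3 q3P] /rat_in_itvoo[q4 q4P]] := lt2 y d d0.
  move: q1P q2P q3P q4P; rewrite !in_itv/=.
  move=> /andP[? ?] /andP[? ?] /andP[? ?] /andP[? ?].
  exists (q1, q2, (q3, q4)); last first.
    by rewrite /box /=; split; rewrite /= in_itv/=; apply/andP; split.
  move=> [a b]; rewrite /box /= !in_itv/= => -[/andP[? ?] /andP[? ?]].
  by apply: UVA; split; [apply: eU|apply: dV] => /=;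
    rewrite /ball/= ltr_norml; lra.
rewrite bigcup_mkcond.
apply: countable_bigcupT_measurable; first exact: countableP.
move=> q; case: ifPn => // _; apply: measurableX; exact: measurable_itv.
Qed.

Lemma closed_measurable2 A : closed A -> measurable A.
Proof. by move/closed_openC/open_measurable2/measurableC; rewrite setCK. Qed.

Lemma compact_measurable2 A : compact A -> measurable A.
Proof.
move=> cA; apply: closed_measurable2.
apply: compact_closed cA => //.
Qed.

Lemma open_continuous_measurable2 D f :
  open D -> {in D, continuous f} -> measurable_fun D f.
Proof.
move=> oD cf; apply: (measurability _ (RGenOpens.measurableE R)).
move=> _ [_ [a [b ->] <-]]; apply: open_measurable2.
rewrite -(continuous_open_subspace f oD) in cf.
have oI : open `]a, b[%classic by exact: interval_open.
have /open_subspaceP[V oV VD] := (continuousP _).1 cf _ oI.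
by rewrite setIC -VD; exact: openI.
Qed.

Lemma continuous_measurable2 f : continuous f -> measurable_fun setT f.
Proof.
by move=> cf; apply: open_continuous_measurable2 => //; exact: openT.
Qed.

End plane_measurability.

Section real_integrable.
Context d (T : measurableType d) (R : realType).
Variable mu : {measure set T -> \bar R}.
Variable D : set T.
Hypothesis mD : measurable D.
Implicit Types f g : T -> R.

Lemma integrable_le f g : measurable_fun D f ->
  (forall x, D x -> `|f x| <= g x) ->
  mu.-integrable D (EFin \o g) -> mu.-integrable D (EFin \o f).
Proof.
move=> mf fg; apply: le_integrable => //; first exact/measurable_EFinP.
by move=> x Dx /=; rewrite lee_fin (le_trans (fg x Dx))// ler_norm.
Qed.

Lemma integrable_meas f : mu.-integrable D (EFin \o f) -> measurable_fun D f.
Proof. by move=> h; apply/measurable_EFinP; exact: measurable_int h. Qed.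

Lemma integrable_scale (r : R) f : mu.-integrable D (EFin \o f) ->
  mu.-integrable D (EFin \o (fun x => r * f x)).
Proof. by move=> h; exact: (integrableZl mD r h). Qed.

Lemma integrable_add f g : mu.-integrable D (EFin \o f) ->
  mu.-integrable D (EFin \o g) ->
  mu.-integrable D (EFin \o (fun x => f x + g x)).
Proof. by move=> hf hg; exact: (integrableD mD hf hg). Qed.

Lemma integrable_sub f g : mu.-integrable D (EFin \o f) ->
  mu.-integrable D (EFin \o g) ->
  mu.-integrable D (EFin \o (fun x => f x - g x)).
Proof. by move=> hf hg; exact: (integrableB mD hf hg). Qed.

Lemma integrable_mul_bounded f g (C : R) : mu.-integrable D (EFin \o f) ->
  measurable_fun D g -> (forall x, D x -> `|g x| <= C) ->
  mu.-integrable D (EFin \o (fun x => f x * g x)).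
Proof.
move=> hf mg gC.
apply: (@integrable_le _ (fun x => C * `|f x|)).
- by apply: measurable_funM => //; exact: integrable_meas.
- by move=> x Dx; rewrite normrM mulrC ler_wpM2r// gC.
- by apply: integrable_scale; exact: (integrable_norm hf).
Qed.

Lemma eq_integrable_real f g : (forall x, D x -> f x = g x) ->
  mu.-integrable D (EFin \o f) -> mu.-integrable D (EFin \o g).
Proof.
move=> fg; apply: eq_integrable => // x; rewrite inE => Dx /=.
by rewrite fg.
Qed.

End real_integrable.

Lemma continuous_pair {T U V : topologicalType} (u : T -> U) (v : T -> V) t :
  {for t, continuous u} -> {for t, continuous v} ->
  {for t, continuous (fun s => (u s, v s))}.
Proof.
move=> cu cv; rewrite /continuous_at/=.
by apply: (@cvg_pair _ _ _ _ (nbhs (u t)) (nbhs (v t))).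
Qed.

Lemma integrable_patch {R : realType} (D : set R) (f : R -> R) : measurable D ->
  (@lebesgue_measure R).-integrable D (EFin \o f) ->
  (@lebesgue_measure R).-integrable setT (EFin \o (f \_ D)).
Proof.
move=> mD iD; rewrite -restrict_EFin.
have [h _] := @integrable_mkcond _ _ _ (@lebesgue_measure R) _ (EFin \o f) mD.
exact: h.
Qed.

Section derivative_rules.
Context {R : realType}.
Implicit Types f g : R -> R.

Lemma derive_eq f (x a b : R) : is_derive x 1 f a -> a = b -> is_derive x 1 f b.
Proof. by move=> d <-. Qed.

Lemma derive_id_fun (x : R) : is_derive x 1 (fun x : R => x) 1.
Proof. exact: is_derive_id. Qed.

Lemma derive_cst_fun (c x : R) : is_derive x 1 (fun=> c) (0 : R).
Proof. exact: is_derive_cst. Qed.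

Lemma derive_add f g (x a b : R) : is_derive x 1 f a -> is_derive x 1 g b ->
  is_derive x 1 (fun x => f x + g x) (a + b).
Proof. by move=> df dg; exact: (is_deriveD df dg). Qed.

Lemma derive_sub f g (x a b : R) : is_derive x 1 f a -> is_derive x 1 g b ->
  is_derive x 1 (fun x => f x - g x) (a - b).
Proof. by move=> df dg; exact: (is_deriveB df dg). Qed.

Lemma derive_mul f g (x a b : R) : is_derive x 1 f a -> is_derive x 1 g b ->
  is_derive x 1 (fun x => f x * g x) (a * g x + f x * b).
Proof.
move=> df dg; apply: derive_eq (is_deriveM df dg) _.
by rewrite /GRing.scale/=; ring.
Qed.

Lemma derive_scale f (c x a : R) : is_derive x 1 f a ->
  is_derive x 1 (fun x => c * f x) (c * a).
Proof. by move=> df; exact: (is_deriveZ c df). Qed.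

Lemma derive_inv f (x a : R) : f x != 0 -> is_derive x 1 f a ->
  is_derive x 1 (fun x => (f x)^-1) (- a / (f x) ^+ 2).
Proof.
move=> fx df; apply: derive_eq (is_deriveV fx df) _.
by rewrite /GRing.scale/= !mulNr mulrC.
Qed.

Lemma derive_comp f g (x a b : R) : is_derive (g x) 1 f a -> is_derive x 1 g b ->
  is_derive x 1 (fun x => f (g x)) (a * b).
Proof. by move=> df dg; exact: (is_derive1_comp df dg). Qed.

Lemma derive_continuous f (df : R -> R) :
  (forall x : R, is_derive x 1 f (df x)) -> continuous f.
Proof.
by move=> h x; apply: differentiable_continuous; apply/derivable1_diffP.
Qed.

End derivative_rules.

(** * Primitives of locally integrable functions *)

Section primitives.
Context {R : realType}.
Local Notation leb := (@lebesgue_measure R).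
Implicit Types (f g : R -> R).

(** Integrability up to the left end point [0], which is what a primitive from
    [0] requires. *)
Definition locint f := forall T, leb.-integrable `[0, T] (EFin \o f).

Definition prim f (t : R) : R := \int[leb]_(s in `[0, t]) f s.

Lemma locintS f a b : locint f -> 0 <= a ->
  leb.-integrable `[a, b] (EFin \o f).
Proof.
move=> lf a0; apply: integrableS (lf b); try exact: measurable_itv.
by apply: subset_itvr; rewrite bnd_simp.
Qed.

Lemma prim_le0 f t : t <= 0 -> prim f t = 0.
Proof.
rewrite /prim le_eqVlt => /predU1P[->|t0]; first by rewrite set_itv1 Rintegral_set1.
by rewrite set_itv_ge ?Rintegral_set0// bnd_simp -ltNge.
Qed.

Lemma prim_sub f a b : locint f -> 0 <= a -> a <= b ->
  prim f b - prim f a = \int[leb]_(s in `[a, b]) f s.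
Proof.
move=> lf a0 ab; rewrite /prim.
rewrite Rintegral_itvB ?bnd_simp//.
rewrite Rintegral_itv_obnd_cbnd//.
apply: integrableS (@locintS f a b lf a0); try exact: measurable_itv.
exact: subset_itv_oc_cc.
Qed.

(** The primitive is constant on the negative half-line.  Continuity at [0] is
    thus not a case apart: [f], extended by [0], is integrable on an interval
    around [t]. *)
Lemma prim_continuous f : locint f -> continuous (prim f).
Proof.
move=> lf t; pose a := - `|t| - 1; pose b := `|t| + 1.
pose f0 := f \_ `[0, +oo[.
have tab : a < t < b.
  by have := ler_norm t; have := ler_norm (- t); rewrite normrN /a /b; lra.
have a0 : a < 0 by have := normr_ge0 t; rewrite /a; lra.
have capE x : `[a, x] `&` `[0, +oo[ = `[0, x]%classic.
  by apply/seteqP; split=> y /=; rewrite !in_itv/= ?andbT => h; lra.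
have if0 : leb.-integrable `[a, b] (EFin \o f0).
  rewrite /f0 -restrict_EFin; apply/integrable_restrict; try exact: measurable_itv.
  by rewrite capE.
have ab : a < b by lra.
have := parameterized_integral_continuous (ltW ab) if0.
rewrite continuous_within_itvP//.
case=> /(_ t); rewrite in_itv/= => /(_ tab) + _ _.
rewrite (_ : (parameterized_integral leb a)^~ f0 = prim f)//.
apply/funext => x; rewrite /parameterized_integral/= /f0 -Rintegral_mkcondr.
by rewrite capE.
Qed.

Lemma lebesgue_aeS (P Q : R -> Prop) : {ae leb, forall x, P x} ->
  (forall x, P x -> Q x) -> {ae leb, forall x, Q x}.
Proof.
move=> + PQ; apply: filterS; first exact: (ae_filter_ringOfSetsType leb).
exact: PQ.
Qed.

Lemma ae_Rintegral_ge0 f (D : set R) : measurable D ->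
  measurable_fun D f -> {ae leb, forall t, D t -> 0 <= f t} ->
  0 <= \int[leb]_(t in D) f t.
Proof.
move=> mD mf f0; rewrite /Rintegral fine_ge0//.
suff -> : (\int[leb]_(x in D) (f x)%:E = \int[leb]_(x in D) `|(f x)%:E|)%E.
  by apply: integral_ge0 => x _; exact: abse_ge0.
apply: ae_eq_integral => //.
- exact/measurable_EFinP.
- by apply: measurableT_comp => //; exact/measurable_EFinP.
- refine (lebesgue_aeS f0 _) => x h Dx.
  by rewrite gee0_abs// lee_fin h.
Qed.

Lemma prim_homo f : locint f -> {ae leb, forall t, 0 <= t -> 0 <= f t} ->
  {homo prim f : s t / s <= t}.
Proof.
move=> lf f0 s t st.
have mf (a b : R) : 0 <= a -> measurable_fun `[a, b] f.
  by move=> a0; apply/measurable_EFinP; exact: measurable_int (@locintS f a b lf a0).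
have fge (a b : R) : 0 <= a -> 0 <= \int[leb]_(t in `[a, b]) f t.
  move=> a0; apply: ae_Rintegral_ge0; [by []|exact: mf|].
  refine (lebesgue_aeS f0 _) => x h; rewrite /= in_itv/= => /andP[ax _].
  by rewrite h// (le_trans a0).
have [s0|/ltW s0] := leP s 0; first by rewrite prim_le0//; exact: fge.
by rewrite -subr_ge0 prim_sub//; exact: fge.
Qed.

Lemma locint_measurable f : locint f -> measurable_fun `[(0:R), +oo[ f.
Proof.
move=> lf.
have -> : `[0, +oo[%classic = \bigcup_n `[0, n%:R]%classic :> set R.
  apply/seteqP; split=> x /=; rewrite in_itv/= ?andbT => h.
    by exists (Num.bound x) => //=; rewrite in_itv/= h ltW// archi_boundP.
  by case: h => n _; rewrite /= !in_itv/= => /andP[->].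
apply/measurable_fun_bigcup => n; first exact: measurable_itv.
by apply/measurable_EFinP; exact: measurable_int (lf _).
Qed.

Lemma locint_bounded f g (C : R) : locint f -> measurable_fun `[(0:R), +oo[ g ->
  (forall t, 0 <= t -> `|g t| <= C) -> locint (fun t => f t * g t).
Proof.
move=> lf mg gC T.
have mT : measurable_fun `[0, T] g.
  by apply: measurable_funS mg => //; exact: subset_itvl.
apply: (@integrable_mul_bounded _ _ _ _ _ _ _ _ C) => // t.
by rewrite /= in_itv/= => /andP[t0 _]; exact: gC.
Qed.

Lemma locint_mul_continuous f g : locint f -> continuous g ->
  locint (fun t => f t * g t).
Proof.
move=> lf cg T.
have /compact_bounded[C [_ CP]] : compact (g @` `[0, T]).
  apply: continuous_compact; last exact: segment_compact.
  exact: continuous_subspaceT.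
apply: (@integrable_mul_bounded _ _ _ _ _ _ _ _ (C + 1)) => //.
  by apply: measurable_funTS; exact: continuous_measurable_fun.
by move=> t tT; apply: CP; [rewrite ltrDl|exists t].
Qed.

Lemma locint_continuous g : continuous g -> locint g.
Proof.
move=> cg T; apply: continuous_compact_integrable; first exact: segment_compact.
exact: continuous_subspaceT.
Qed.

Lemma locint_cst (r : R) : locint (cst r).
Proof. by apply: locint_continuous => x; exact: cvg_cst. Qed.

Lemma locint_scale r f : locint f -> locint (fun t => r * f t).
Proof. by move=> lf T; exact: integrable_scale. Qed.

Lemma prim_scale r f t : locint f -> prim (fun s => r * f s) t = r * prim f t.
Proof. by move=> lf; rewrite /prim RintegralZl. Qed.

End primitives.

Section coefficients.
Context {R : realType}.
Local Notation leb := (@lebesgue_measure R).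
Variables (alpha sigma : R -> R).
Hypothesis alpha_ge0 : {ae leb, forall t, 0 <= t -> 0 <= alpha t}.
Hypothesis alpha_L1 : leb.-integrable `[0, +oo[ (EFin \o alpha).
Hypothesis sigma_ge0 : {ae leb, forall t, 0 <= t -> 0 <= sigma t}.
Hypothesis sigma_L1loc : L1_loc sigma.

Lemma locint_sigma : locint sigma.
Proof.
move=> T; apply: sigma_L1loc; first exact: segment_compact.
exact: subset_itvl.
Qed.

Lemma locint_alpha : locint alpha.
Proof. by move=> T; apply: integrableS alpha_L1 => //; exact: subset_itvl. Qed.

Lemma dampingE : damping sigma = fun t => expR (- prim sigma t).
Proof. by []. Qed.

Lemma damping_continuous : continuous (damping sigma).
Proof.
move=> t; rewrite dampingE.
apply: (@continuous_comp _ _ _ (fun t => - prim sigma t) expR); last exact: continuous_expR.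
by apply: continuousN; apply: prim_continuous; exact: locint_sigma.
Qed.

Lemma damping_gt0 t : 0 < damping sigma t. Proof. exact: expR_gt0. Qed.

Lemma damping_le1 t : damping sigma t <= 1.
Proof.
rewrite dampingE -expR0 ler_expR oppr_le0.
have [t0|/ltW t0] := leP t 0; first by rewrite prim_le0.
by rewrite -(@prim_le0 _ sigma 0)// prim_homo//; exact: locint_sigma.
Qed.

Lemma locint_beta : locint (beta alpha sigma).
Proof.
apply: (@locint_bounded _ _ _ 1) => //; first exact: locint_alpha.
- apply: measurable_funS (continuous_measurable_fun damping_continuous) => //.
- by move=> t _; rewrite ger0_norm ?damping_le1// ltW// damping_gt0.
Qed.

Lemma Bint_continuous : continuous (Bint alpha sigma).
Proof. exact: prim_continuous locint_beta. Qed.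

Lemma Bint_homo : {homo Bint alpha sigma : s t / s <= t}.
Proof.
apply: prim_homo; first exact: locint_beta.
refine (lebesgue_aeS alpha_ge0 _) => t h t0.
by rewrite mulr_ge0 ?h// ltW// damping_gt0.
Qed.

Lemma Bint_le0 t : t <= 0 -> Bint alpha sigma t = 0.
Proof. exact: prim_le0. Qed.

Lemma Bint_ge0 t : 0 <= Bint alpha sigma t.
Proof.
have [t0|/ltW t0] := leP t 0; first by rewrite Bint_le0.
by rewrite -(@Bint_le0 0)// Bint_homo.
Qed.

End coefficients.

(** * Integrals over the upper half-plane *)

Section upper_half_plane.
Context {R : realType}.
Local Notation leb := (@lebesgue_measure R).
Implicit Types (F : R * R -> R) (h : R -> R).

Lemma measurable_upper : measurable (@upper R).
Proof.
apply: open_measurable2; rewrite /upper.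
have -> : [set p : R * R | 0 < p.2] = snd @^-1` [set x | 0 < x] by [].
apply: open_comp; last exact: open_gt.
by move=> p _; exact: cvg_snd.
Qed.

Lemma integrable_upperP F : leb2.-integrable upper (EFin \o F) <->
  leb2.-integrable setT (EFin \o (F \_ upper)).
Proof.
have -> : EFin \o (F \_ upper) = (EFin \o F) \_ (@upper R).
  by rewrite restrict_EFin.
apply: integrable_mkcond; exact: measurable_upper.
Qed.

Lemma integrable_prod (a b : R -> R) :
  leb.-integrable setT (EFin \o a) -> leb.-integrable setT (EFin \o b) ->
  leb2.-integrable setT (EFin \o (fun p => a p.1 * b p.2)).
Proof.
move=> ia ib.
have ma := integrable_meas ia.
have mb := integrable_meas ib.
apply/integrable12ltyP.
  apply/measurable_EFinP; apply: measurable_funM.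
    by apply: measurableT_comp ma _; exact: measurable_fst.
  by apply: measurableT_comp mb _; exact: measurable_snd.
under eq_integral do under eq_integral do rewrite /= normrM EFinM.
have -> : (\int[leb]_x \int[leb]_y (`|a x|%:E * `|b y|%:E) =
   \int[leb]_x (`|a x|%:E * \int[leb]_y `|b y|%:E))%E.
  apply: eq_integral => x _ /=.
  rewrite ge0_integralZl//.
  by apply/measurable_EFinP; exact: measurableT_comp.
rewrite ge0_integralZr//.
- case/integrableP : ia => _ ia; case/integrableP : ib => _ ib.
  by rewrite lte_mul_pinfty ?ge0_fin_numE//; exact: integral_ge0.
- by apply/measurable_EFinP; exact: measurableT_comp.
- by apply: integral_ge0.
Qed.

Lemma Rintegral_ae_fine (G : R -> \bar R) : leb.-integrable setT G ->
  \int[leb]_t fine (G t) = fine (\int[leb]_t G t)%E.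
Proof.
move=> iG; rewrite /Rintegral; congr fine.
apply: ae_eq_integral => //.
- apply/measurable_EFinP; apply: measurableT_comp => //.
  exact: measurable_int iG.
- exact: measurable_int iG.
- have := integrable_ae measurableT iG.
  by move=> iae; refine (lebesgue_aeS iae _) => t h Dt; rewrite fineK// h.
Qed.

(** The modulus of the integral over a slice is at most the integral of the
    modulus, whose integral over the slices is finite. *)
Lemma integrable_slices (F : R * R -> \bar R) : leb2.-integrable setT F ->
  leb.-integrable setT (fubini_G leb F).
Proof.
move=> iF; have mF := measurable_int _ iF.
apply/integrableP; split; first exact: (measurable_fubini_G iF).
have : (\int[leb]_y \int[leb]_x `|F (x, y)| < +oo)%E.
  by apply/integrable21ltyP.
apply: le_lt_trans.
have mFt t : measurable_fun setT (fun x => F (x, t)).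
  by apply: measurableT_comp mF _; exact: pair2_measurable.
apply: ge0_le_integral => //.
- by apply: measurableT_comp => //; exact: (measurable_fubini_G iF).
- have mA : measurable_fun setT (abse \o F) by exact: measurableT_comp.
  exact: (@measurable_fun_fubini_tonelli_G _ _ _ _ _ leb _ mA (fun=> abse_ge0 _)).
- by move=> t _; exact: (le_abse_integral leb measurableT (mFt t)).
Qed.

Lemma int_upper_tx F : leb2.-integrable upper (EFin \o F) ->
  int_upper F = \int[leb]_(t in `]0, +oo[) \int[leb]_x F (x, t).
Proof.
move=> /integrable_upperP iF.
rewrite /int_upper Rintegral_mkcond /Rintegral.
rewrite -(integral21_prod_meas1 iF) -Rintegral_ae_fine; last first.
  exact: integrable_slices.
rewrite -/(Rintegral _ _ _) [RHS]Rintegral_mkcond; apply: eq_Rintegral => t _.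
rewrite /fubini_G /patch; case: ifPn => [|].
  rewrite inE/= in_itv/= andbT => t0; congr fine; apply: eq_integral => x _ /=.
  by rewrite ifT// inE.
rewrite notin_setE/= in_itv/= andbT => t0.
rewrite integral0_eq// => x _ /=; rewrite ifF//.
by apply/negbTE; rewrite notin_setE /upper /=.
Qed.

Lemma int_upper_xt F : leb2.-integrable upper (EFin \o F) ->
  int_upper F = \int[leb]_x \int[leb]_(t in `]0, +oo[) F (x, t).
Proof.
move=> /integrable_upperP iF.
rewrite /int_upper Rintegral_mkcond /Rintegral.
rewrite -(integral12_prod_meas1 iF) -Rintegral_ae_fine; last first.
  exact: integrable_fubini_F.
apply: eq_Rintegral => x _.
rewrite /fubini_F [in RHS]integral_mkcond; congr fine.
apply: eq_integral => t _; rewrite /patch /=.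
have [t0|t0] := boolP (0 < t).
  by rewrite !ifT// ?inE//= in_itv/= t0.
by rewrite !ifF//; apply/negbTE; rewrite notin_setE /upper/= ?in_itv/= ?andbT;
  exact/negP.
Qed.

Lemma lebesgue_measure_translation (a : R) (A : set R) : measurable A ->
  pushforward leb ((fun y => y + a) : _ -> measurableTypeR R) A = leb A.
Proof.
move=> mA; apply/esym/lebesgue_measure_unique => //=.
  exact: measurable_funD.
move=> _ _ [[x y]] _ <-.
rewrite /pushforward /=.
have -> : (fun z : R => z + a) @^-1` `]x, y] = `]x - a, y - a]%classic.
  by apply/seteqP; split=> z /=; rewrite !in_itv/= => h; lra.
rewrite !lebesgue_measure_itv/= !lte_fin ltrD2r.
by case: ifP => // _; rewrite -!EFinB; congr EFin; ring.
Qed.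

Section shear.
Variable X : R -> R.
Hypothesis mX : measurable_fun setT X.

Local Notation plane := (measurableTypeR R * measurableTypeR R)%type.

Definition shear (p : plane) : plane := (p.1 + X p.2, p.2).

Lemma measurable_shear : measurable_fun setT shear.
Proof.
apply/measurable_fun_pairP; split=> /=.
  apply: measurable_funD; first exact: measurable_fst.
  exact: measurableT_comp mX measurable_snd.
exact: measurable_snd.
Qed.

(** Each horizontal line is only translated, so that the sections of a set keep
    their length. *)
Lemma leb2_shear (A : set (R * R)) : measurable A ->
  leb2 A = pushforward leb2 shear A.
Proof.
move=> mA; have ms := measurable_shear.
pose m : {measure set plane -> \bar R} := pushforward leb2 shear.
refine (@product_measure_unique _ _ _ _ _ leb leb (m ms) _ A mA) => U V mU mV.
rewrite /m /= /pushforward /leb2.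
transitivity ((leb \x^ leb)%E (shear @^-1` (U `*` V))).
  apply: product_measure_unique.
    by move=> ? ? ? ?; exact: product_measure2E.
  by rewrite -[X in measurable X]setTI; apply: ms => //; exact: measurableX.
rewrite -product_measure2E// /product_measure2.
apply: eq_integral => t _ /=.
have [tV|tV] := boolP (t \in V).
  rewrite in_ysectionX// -(lebesgue_measure_translation (X t) mU) /pushforward.
  congr (leb _); apply/seteqP; split => y /=.
    by rewrite ysectionE/= => -[].
  by rewrite ysectionE/= => ?; split => //=; exact: set_mem.
rewrite notin_ysectionX// measure0.
rewrite (_ : ysection _ _ = set0) ?measure0//.
apply/seteqP; split => y //=; rewrite ysectionE/= => -[_ /= /mem_set].
by rewrite (negbTE tV).
Qed.

Lemma int_upper_shear F : leb2.-integrable upper (EFin \o F) ->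
  leb2.-integrable upper (EFin \o (F \o shear)) /\
  int_upper F = int_upper (F \o shear).
Proof.
move=> /integrable_upperP iF; have ms := measurable_shear.
have mF := measurable_int _ iF.
have FE : (F \o shear) \_ upper = (F \_ upper) \o shear.
  by apply/funext => p /=; rewrite /patch.
have iS : leb2.-integrable setT (EFin \o ((F \o shear) \_ upper)).
  rewrite FE; apply/integrableP; split.
    exact: (measurableT_comp mF ms).
  case/integrableP: iF => _; apply: le_lt_trans.
  rewrite le_eqVlt; apply/orP; left; apply/eqP.
  rewrite [RHS](eq_measure_integral (pushforward leb2 shear)); last first.
    by move=> A mA _; exact: leb2_shear.
  rewrite ge0_integral_pushforward//.
  exact: measurableT_comp.
split; first exact/integrable_upperP.
rewrite /int_upper Rintegral_mkcond [RHS]Rintegral_mkcond FE /Rintegral.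
congr fine.
rewrite [LHS](eq_measure_integral (pushforward leb2 shear)); last first.
  by move=> A mA _; exact: leb2_shear.
by rewrite integral_pushforward// preimage_setT -FE.
Qed.

End shear.

Implicit Types G : R * R -> R.
Local Notation plane := (measurableTypeR R * measurableTypeR R)%type.

Lemma upper_integrable_le F G : measurable_fun upper F ->
  (forall p, upper p -> `|F p| <= G p) ->
  leb2.-integrable upper (EFin \o G) -> leb2.-integrable upper (EFin \o F).
Proof.
move=> mF FG iG.
exact: (@integrable_le _ plane R leb2 upper measurable_upper F G mF FG iG).
Qed.

Lemma upper_integrableT F : leb2.-integrable setT (EFin \o F) ->
  leb2.-integrable upper (EFin \o F).
Proof.
exact: (@integrableS _ plane R leb2 setT upper _ measurableT measurable_upper).
Qed.

Lemma upper_integrable_scale r F : leb2.-integrable upper (EFin \o F) ->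
  leb2.-integrable upper (EFin \o (fun p => r * F p)).
Proof.
exact: (@integrable_scale _ plane R leb2 upper measurable_upper r F).
Qed.

Lemma upper_integrable_add F G : leb2.-integrable upper (EFin \o F) ->
  leb2.-integrable upper (EFin \o G) ->
  leb2.-integrable upper (EFin \o (fun p => F p + G p)).
Proof.
move=> iF iG.
exact: (@integrable_add _ plane R leb2 upper measurable_upper F G iF iG).
Qed.

Lemma upper_eq_integrable F G : (forall p, upper p -> F p = G p) ->
  leb2.-integrable upper (EFin \o F) -> leb2.-integrable upper (EFin \o G).
Proof.
move=> FG.
exact: (@eq_integrable_real _ plane R leb2 upper measurable_upper F G FG).
Qed.

Lemma int_upperD F G : leb2.-integrable upper (EFin \o F) ->
  leb2.-integrable upper (EFin \o G) ->
  int_upper (fun p => F p + G p) = int_upper F + int_upper G.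
Proof.
move=> iF iG.
exact: (@RintegralD _ plane R leb2 upper F G measurable_upper iF iG).
Qed.

Lemma eq_int_upper F G : (forall p, upper p -> F p = G p) ->
  int_upper F = int_upper G.
Proof. by move=> FG; apply: eq_Rintegral => p; rewrite inE => /FG. Qed.

End upper_half_plane.

(** * The chain rule for absolutely continuous curves *)

Section chain_rule.
Context {R : realType}.
Local Notation leb := (@lebesgue_measure R).

(** A substitute for the vanishing of a derivative: [G] plays the role of the
    variable.  The bound [`|K t - K 0| <= e * (G t - G 0)] is pushed from [0] to
    [M] by considering the supremum of the times up to which it is known, and
    [e] is arbitrary. *)
Lemma local_increments_global (K G : R -> R) (M : R) : 0 <= M ->
  (forall e t0 : R, 0 < e -> 0 <= t0 <= M -> exists2 d, 0 < d &
    forall s t : R, 0 <= s -> s <= t -> t <= M -> `|s - t0| < d -> `|t - t0| < d ->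
      `|K t - K s| <= e * (G t - G s)) ->
  K M = K 0.
Proof.
move=> M0 loc.
suff main e : 0 < e -> `|K M - K 0| <= e * (G M - G 0).
  apply/eqP; rewrite -subr_eq0 -normr_le0; apply/ler_addgt0Pr => e e0.
  rewrite add0r; pose g := `|G M - G 0| + 1.
  have g0 : 0 < g by rewrite ltr_wpDl.
  apply: (le_trans (main (e / g) _)); first by rewrite divr_gt0.
  rewrite mulrAC ler_pdivrMr// ler_pM2l//.
  by rewrite (le_trans (ler_norm _))// lerDl.
move=> e0.
pose S := [set t | 0 <= t <= M /\ `|K t - K 0| <= e * (G t - G 0)].
have S0 : S 0 by split; rewrite ?lexx ?M0// !subrr normr0 mulr0.
have supS : has_sup S by split; [exists 0|exists M => t [/andP[]]].
pose c := sup S.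
have c0M : 0 <= c <= M.
  rewrite ub_le_sup//=; last by case: supS.
  by apply: ge_sup; [exists 0|move=> t [/andP[]]].
have [d d0 locd] := loc e c e0 c0M.
have [s Ss cs] := sup_adherent d0 supS.
have sc : s <= c by apply: ub_le_sup Ss; case: supS.
case: Ss => /andP[s0 sM] Ks.
pose t := Num.min M (c + d / 2).
have tM : t <= M by rewrite /t ge_min lexx.
have ct : c <= t by rewrite /t le_min; lra.
have tc2 : t <= c + d / 2 by rewrite /t ge_min lexx orbT.
have St : S t.
  split; first by lra.
  have -> : K t - K 0 = (K t - K s) + (K s - K 0) by ring.
  have -> : e * (G t - G 0) = e * (G t - G s) + e * (G s - G 0) by ring.
  rewrite (le_trans (ler_normD _ _))// lerD//.
  apply: locd => //; first lra.
    by rewrite ler0_norm; rewrite -/c in cs; lra.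
  by rewrite ger0_norm; lra.
have tc : t <= c by apply: ub_le_sup St; case: supS.
have MtE : t = M.
  by move: tc; rewrite /t minElt; case: ifPn => // _; lra.
by rewrite -MtE; case: St.
Qed.

Lemma MVT_ball (f df : R -> R) (x0 r a b : R) :
  (forall x : R, is_derive x 1 f (df x)) -> `|a - x0| < r -> `|b - x0| < r ->
  exists2 c, `|c - x0| < r & f b - f a = df c * (b - a).
Proof.
move=> fd.
have cf x : {for x, continuous f}.
  by apply: differentiable_continuous; apply/derivable1_diffP.
wlog ab : a b / a <= b => [wl|] ar br.
  have [/wl|/ltW /wl] := leP a b; first exact.
  move=> /(_ br ar)[c cr E]; exists c => //.
  by rewrite -opprB E -mulrN opprB.
have [c] := MVT_segment ab (fun x _ => fd x) (continuous_subspaceT cf).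
rewrite in_itv/= => /andP[ac cb] E; exists c => //.
by move: ar br; rewrite !ltr_norml => /andP[? ?] /andP[? ?]; lra.
Qed.

Lemma continuous_prod_modulus (e : R -> R) (f : R * R -> R) a0 x0 t0 (r : R) :
  continuous e -> continuous f -> 0 < r ->
  exists2 d, 0 < d & forall a x t, `|a - a0| < d -> `|x - x0| < d ->
    `|t - t0| < d -> `|e a * f (x, t) - e a0 * f (x0, t0)| <= r.
Proof.
move=> ce cf r0.
have : (fun q : R * (R * R) => e q.1 * f q.2) q @[q --> (a0, (x0, t0))] -->
       e a0 * f (x0, t0).
  apply: cvgM; apply: continuous_comp => /=.
  - exact: cvg_fst.
  - exact: ce.
  - exact: cvg_snd.
  - exact: cf.
move=> /cvgrPdist_le/(_ _ r0)/nbhs_ballP[d /= d0 dP].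
exists d => // a x t ha hx ht.
rewrite distrC; apply: (dP (a, (x, t))).
by split => /=; [|split => /=]; rewrite /ball/= distrC.
Qed.

Lemma ball_between (c r s t x : R) : s <= x -> x <= t ->
  `|s - c| < r -> `|t - c| < r -> `|x - c| < r.
Proof. by rewrite !ltr_norml => ? ? /andP[? ?] /andP[? ?]; lra. Qed.

Lemma ler_dist_half (e L x z : R) :
  `|x - L| <= e / 2 -> `|z - L| <= e / 2 -> `|x - z| <= e.
Proof. by rewrite !ler_norml => /andP[? ?] /andP[? ?]; lra. Qed.

Variables (a g : R -> R) (eta deta : R -> R) (phi phix phit : R * R -> R).
Hypothesis la : locint a.
Hypothesis lg : locint g.
Hypothesis deta_cont : continuous deta.
Hypothesis eta_deriv : forall x : R, is_derive x 1 eta (deta x).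
Hypothesis phi_cont : continuous phi.
Hypothesis phix_cont : continuous phix.
Hypothesis phit_cont : continuous phit.
Hypothesis phi_x : forall x t : R, is_derive x 1 (fun x => phi (x, t)) (phix (x, t)).
Hypothesis phi_t : forall x t : R, is_derive t 1 (fun t => phi (x, t)) (phit (x, t)).
Variable y : R.

Let A := prim a.
Let X t := y + prim g t.
Let H t := eta (A t) * phi (X t, t).
Let h t := deta (A t) * a t * phi (X t, t) +
  eta (A t) * (phit (X t, t) + g t * phix (X t, t)).

Let eta_cont : continuous eta.
Proof.
by move=> x; apply: differentiable_continuous; apply/derivable1_diffP.
Qed.

Let A_cont : continuous A. Proof. exact: prim_continuous. Qed.

Let X_cont : continuous X.
Proof. by move=> t; apply: continuousD; [exact: cvg_cst|exact: prim_continuous]. Qed.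

Let XT_cont (f : R * R -> R) : continuous f -> continuous (fun t => f (X t, t)).
Proof.
move=> cf t; apply: (@continuous_comp _ _ _ (fun t => (X t, t)) f); last exact: cf.
by apply: continuous_pair; [exact: X_cont|exact: cvg_id].
Qed.

Lemma chain_rule_integrable : locint h.
Proof.
move=> T.
pose q1 t := deta (A t) * phi (X t, t).
pose q2 t := eta (A t) * phit (X t, t).
pose q3 t := eta (A t) * phix (X t, t).
have qc (e : R -> R) (f : R * R -> R) : continuous e -> continuous f ->
    continuous (fun t => e (A t) * f (X t, t)).
  move=> ce cf t; apply: cvgM; last exact: XT_cont.
  by apply: continuous_comp; [exact: A_cont|exact: ce].
have iq1 := locint_mul_continuous la (qc _ _ deta_cont phi_cont) T.
have iq2 := locint_continuous (qc _ _ eta_cont phit_cont) T.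
have iq3 := locint_mul_continuous lg (qc _ _ eta_cont phix_cont) T.
have := integrable_add _ (integrable_add _ iq1 iq2) iq3.
move=> /(_ (measurable_itv _) (measurable_itv _)).
apply: eq_integrable_real => // t _.
by rewrite /h /q1 /q2 /q3 /=; ring.
Qed.

(** The product and chain rules along [t |-> (prim a t, y + prim g t, t)]: [a]
    and [g] being merely integrable, none of the two primitives need be
    differentiable. *)
Lemma chain_rule_primitive (M : R) : 0 <= M ->
  H M - H 0 = \int[leb]_(t in `[0, M]) h t.
Proof.
move=> M0; rewrite -[RHS]/(prim h M).
pose G t := prim (fun t => `|a t| + `|g t| + 1) t.
pose K t := H t - prim h t.
suff : K M = K 0 by rewrite /K [prim h 0]prim_le0// => E; lra.
apply: (@local_increments_global K G M M0) => e t0 e0 t0M.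
have e20 : 0 < e / 2 by rewrite divr_gt0.
have [d1 d10 d1P] := @continuous_prod_modulus deta phi (A t0) (X t0) t0 _
  deta_cont phi_cont e20.
have [d2 d20 d2P] := @continuous_prod_modulus eta phix (A t0) (X t0) t0 _
  eta_cont phix_cont e20.
have [d3 d30 d3P] := @continuous_prod_modulus eta phit (A t0) (X t0) t0 _
  eta_cont phit_cont e20.
have [d [d0 dd1 dd2 dd3]] : exists d : R, [/\ 0 < d, d <= d1, d <= d2 & d <= d3].
  exists (Num.min d1 (Num.min d2 d3)).
  by split; rewrite ?lt_min ?d10 ?d20 ?d30// !ge_min lexx ?orbT.
have [dA dA0 dAP] : exists2 r, 0 < r & forall t, `|t - t0| < r -> `|A t - A t0| < d.
  have /cvgrPdist_lt/(_ _ d0) := @A_cont t0; move=> /nbhs_ballP[r /= r0 rP].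
  by exists r => // t tr; rewrite distrC; apply: rP; rewrite /ball/= distrC.
have [dX dX0 dXP] : exists2 r, 0 < r & forall t, `|t - t0| < r -> `|X t - X t0| < d.
  have /cvgrPdist_lt/(_ _ d0) := @X_cont t0; move=> /nbhs_ballP[r /= r0 rP].
  by exists r => // t tr; rewrite distrC; apply: rP; rewrite /ball/= distrC.
exists (Num.min d (Num.min dA dX)); first by rewrite !lt_min d0 dA0 dX0.
move=> s t s0 st tM; rewrite !lt_min => /and3P[sd sA sX] /and3P[td tA tX].
have As := dAP _ sA; have At := dAP _ tA.
have Xs := dXP _ sX; have Xt := dXP _ tX.
have [xi1 xi1d E1] := MVT_ball eta_deriv As At.
have [xi2 xi2d E2] := MVT_ball (phi_x ^~ t) Xs Xt.
have [xi3 xi3d E3] := MVT_ball (phi_t (X s)) sd td.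
(* On a short interval [H] grows like the primitive of [h] with the coefficients
   of [a], [g] and [1] frozen at the values given by the mean value theorem. *)
pose c1 := deta xi1 * phi (X t, t).
pose c2 := eta (A s) * phix (xi2, t).
pose c3 := eta (A s) * phit (X s, xi3).
have ist (f : R -> R) : locint f -> leb.-integrable `[s, t] (EFin \o f).
  by move=> lf; exact: locintS.
have i1 := ist _ (locint_cst 1).
pose k tau := c1 * a tau + c2 * g tau + c3 * 1 - h tau.
have ik : leb.-integrable `[s, t] (EFin \o k).
  apply: integrable_sub => //; last exact: ist chain_rule_integrable.
  apply: integrable_add => //; last exact: integrable_scale.
  by apply: integrable_add => //; apply: integrable_scale => //; exact: ist.
have KE : K t - K s = \int[leb]_(tau in `[s, t]) k tau.
  have HE : H t - H s = c1 * (A t - A s) + c2 * (X t - X s) + c3 * (t - s).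
    rewrite /c1 /c2 /c3 [deta _ * _ * _]mulrAC -E1.
    have -> : eta (A s) * phix (xi2, t) * (X t - X s) =
        eta (A s) * (phi (X t, t) - phi (X s, t)) by rewrite E2 mulrA.
    have -> : eta (A s) * phit (X s, xi3) * (t - s) =
        eta (A s) * (phi (X s, t) - phi (X s, s)) by rewrite E3 mulrA.
    by rewrite /H; ring.
  rewrite /k RintegralB//; last 2 first.
  - apply: integrable_add => //; last exact: integrable_scale.
    by apply: integrable_add => //; apply: integrable_scale => //; exact: ist.
  - exact: ist chain_rule_integrable.
  rewrite RintegralD//; last 2 first.
  - by apply: integrable_add => //; apply: integrable_scale => //; exact: ist.
  - exact: integrable_scale.
  rewrite RintegralD//; last 2 first.
  - by apply: integrable_scale => //; exact: ist.
  - by apply: integrable_scale => //; exact: ist.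
  rewrite !RintegralZl//; [|exact: ist|exact: ist].
  rewrite -(prim_sub la)// -(prim_sub lg)// -(prim_sub chain_rule_integrable)//.
  rewrite Rintegral_cst//= lebesgue_measure_itv/= lte_fin.
  have -> : K t - K s = (H t - H s) - (prim h t - prim h s) by rewrite /K; ring.
  rewrite HE /X /A; case: ltP => ts /=; first by ring.
  have -> : t = s by apply/eqP; rewrite eq_le ts st.
  by ring.
have abst : locint (fun t => `|a t| + `|g t| + 1).
  move=> S; apply: integrable_add => //.
    apply: integrable_add => //; first exact: (integrable_norm (la S)).
    exact: (integrable_norm (lg S)).
  exact: locint_cst.
rewrite KE /G prim_sub// -RintegralZl//; last exact: ist.
rewrite (le_trans (le_normr_Rintegral _ ik))//.
apply: le_Rintegral => //; first exact: (integrable_norm ik).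
  by apply: integrable_scale => //; exact: ist.
move=> tau; rewrite /= in_itv/= => /andP[stau taut].
(* The frozen coefficients and the actual ones are within [e / 2] of their
   common values at [t0]. *)
have between r := @ball_between t0 r s t tau stau taut.
have Atau := dAP _ (between _ sA tA).
have Xtau := dXP _ (between _ sX tX).
have taud := between _ sd td.
have B1 : `|c1 - deta (A tau) * phi (X tau, tau)| <= e.
  by apply: (@ler_dist_half _ (deta (A t0) * phi (X t0, t0))); apply: d1P;
    rewrite (lt_le_trans _ dd1).
have B2 : `|c2 - eta (A tau) * phix (X tau, tau)| <= e.
  by apply: (@ler_dist_half _ (eta (A t0) * phix (X t0, t0))); apply: d2P;
    rewrite (lt_le_trans _ dd2).
have B3 : `|c3 - eta (A tau) * phit (X tau, tau)| <= e.
  by apply: (@ler_dist_half _ (eta (A t0) * phit (X t0, t0))); apply: d3P;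
    rewrite (lt_le_trans _ dd3).
have -> : k tau = (c1 - deta (A tau) * phi (X tau, tau)) * a tau +
   (c2 - eta (A tau) * phix (X tau, tau)) * g tau +
   (c3 - eta (A tau) * phit (X tau, tau)) * 1 by rewrite /k /h; ring.
rewrite !mulrDr (le_trans (ler_normD _ _))// lerD//; last by rewrite !mulr1.
by rewrite (le_trans (ler_normD _ _))// lerD// normrM ler_wpM2r.
Qed.

End chain_rule.

(** * Test functions *)

Section test_functions.
Context {R : realType}.
Local Notation leb := (@lebesgue_measure R).
Implicit Types (f phi : R * R -> R).

(** A support condition without closures, which passes to slices at once. *)
Definition vanish (M : R) f :=
  forall p, M <= `|p.1| \/ M <= `|p.2| -> f p = 0.

Lemma is_derive_dx phi (x t : R) : derivable phi (x, t) (1, 0) ->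
  is_derive x 1 (fun x : R => phi (x, t)) (dx phi (x, t)).
Proof.
have E : (fun h : R => h^-1 *: (phi (h *: (1, 0) + (x, t)) - phi (x, t))) =
         (fun h : R => h^-1 *: (phi (h *: 1 + x, t) - phi (x, t))).
  apply/funext => h; congr (_ *: (phi _ - _)).
  rewrite (_ : h *: (1, 0) + (x, t) = (h *: 1 + x, h *: 0 + t))//.
  by rewrite scaler0 add0r.
move=> d; constructor.
  by move: d; rewrite /derivable E.
by rewrite /dx /derive E.
Qed.

Lemma is_derive_dt phi (x t : R) : derivable phi (x, t) (0, 1) ->
  is_derive t 1 (fun t : R => phi (x, t)) (dt phi (x, t)).
Proof.
have E : (fun h : R => h^-1 *: (phi (h *: (0, 1) + (x, t)) - phi (x, t))) =
         (fun h : R => h^-1 *: (phi (x, h *: 1 + t) - phi (x, t))).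
  apply/funext => h; congr (_ *: (phi _ - _)).
  rewrite (_ : h *: (0, 1) + (x, t) = (h *: 0 + x, h *: 1 + t))//.
  by rewrite scaler0 add0r.
move=> d; constructor.
  by move: d; rewrite /derivable E.
by rewrite /dt /derive E.
Qed.

(** [N] is larger than [M] because the derivative at a point involves values at
    neighbouring points. *)
Lemma vanish_derive (M N : R) phi (v p : R * R) : M < N -> vanish M phi ->
  N <= `|p.1| \/ N <= `|p.2| -> 'D_v phi p = 0.
Proof.
move=> MN vphi Np.
have phi0 : \near p, phi p = cst 0 p.
  have oM : open [set x : R | M < `|x|].
    rewrite (_ : [set x | _] = Num.norm @^-1` [set y : R | M < y])//.
    apply: open_comp; last exact: open_gt.
    by move=> x _; exact: norm_continuous.
  have {}Np : M < `|p.1| \/ M < `|p.2| by case: Np => h; [left|right]; lra.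
  case: Np => Np.
    have oA : open (fst @^-1` [set x : R | M < `|x|] : set (R * R)).
      by apply: open_comp => // q _; exact: cvg_fst.
    have := open_nbhs_nbhs (conj oA Np).
    by apply: filterS => q /= qM; apply: vphi; left; exact: ltW.
  have oA : open (snd @^-1` [set x : R | M < `|x|] : set (R * R)).
    by apply: open_comp => // q _; exact: cvg_snd.
  have := open_nbhs_nbhs (conj oA Np).
  by apply: filterS => q /= qM; apply: vphi; right; exact: ltW.
by rewrite (near_eq_derive v phi0) derive_cst.
Qed.

Lemma compact_vanish phi : compact (supp phi) -> exists2 M, 0 < M & vanish M phi.
Proof.
move=> /compact_bounded[C [_ CP]]; pose M := `|C| + 1 + 1.
exists M; first by rewrite !ltr_wpDl.
move=> p Mp; apply/eqP/negPn/negP => phi0.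
have : `|p| <= `|C| + 1.
  by apply: CP; [rewrite ltr_pwDr// ler_norm|exact: subset_closure].
rewrite prod_normE ge_max => /andP[? ?].
by case: Mp; rewrite /M; lra.
Qed.

(** Uniform data on a test function, in the form used below. *)
Lemma test_closed_data phi : test_closed phi -> exists M : R,
  [/\ 0 < M, [/\ continuous phi, continuous (dx phi) & continuous (dt phi)],
      [/\ vanish M phi, vanish M (dx phi) & vanish M (dt phi)],
      forall x t : R, is_derive x 1 (fun x : R => phi (x, t)) (dx phi (x, t)) &
      forall x t : R, is_derive t 1 (fun t : R => phi (x, t)) (dt phi (x, t))].
Proof.
move=> [smooth_phi /compact_vanish[M M0 vM]].
have [cphi dphix dphit [cx _ _ _ _] [ct _ _ _ _]] := smooth_phi 2%N.
have vMp q : M + 1 <= `|q.1| \/ M + 1 <= `|q.2| -> M <= `|q.1| \/ M <= `|q.2|.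
  by case=> h; [left|right]; rewrite (le_trans _ h)// lerDl.
have MM : M < M + 1 by rewrite ltrDl.
exists (M + 1); split.
- by rewrite ltr_wpDl// ltW.
- by split; [exact: cphi|exact: cx|exact: ct].
- split=> p h; first by apply: vM; exact: vMp.
  + by rewrite /dx (vanish_derive _ MM vM h).
  + by rewrite /dt (vanish_derive _ MM vM h).
- by move=> x t; apply: is_derive_dx; exact: dphix.
- by move=> x t; apply: is_derive_dt; exact: dphit.
Qed.

Lemma vanish_bounded f M : continuous f -> vanish M f ->
  exists C, forall p, `|f p| <= C.
Proof.
move=> cf vf; pose K : set (R * R) := `[- M, M]%classic `*` `[- M, M]%classic.
have /compact_bounded[C [_ CP]] : compact (f @` K).
  apply: continuous_compact; first exact: continuous_subspaceT.
  by apply: compact_setX; exact: segment_compact.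
exists (`|C| + 1) => p.
have C0 : 0 <= `|C| + 1 by rewrite addr_ge0.
have [pK|pK] := pselect (K p).
  apply: CP; first by rewrite ltr_pwDr// ler_norm.
  by exists p.
rewrite vf ?normr0//; apply: contrapT => /not_orP[/negP + /negP].
rewrite -!ltNge !ltr_norml => h1 h2; apply: pK.
by split; rewrite /= in_itv/=; lra.
Qed.

(** The dominating function is a product: the indicator of [`[- M, M]] in [x] and
    the restriction of [`|h|] to [`[0, M]] in [t]. *)
Lemma integrable_upper (h : R -> R) (g f : R * R -> R) (C M : R) : locint h ->
  measurable_fun upper g -> (forall p, upper p -> `|g p| <= C) ->
  continuous f -> vanish M f ->
  leb2.-integrable upper (EFin \o (fun p => h p.2 * g p * f p)).
Proof.
move=> lh mg gC cf vf.
have [D fD] := vanish_bounded cf vf.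
have mU := @measurable_upper R.
pose a : R -> R := \1_(`[- M, M]%classic : set R).
pose b : R -> R := (Num.norm \o h) \_ `[0, M].
have ia : leb.-integrable setT (EFin \o a) by exact: integrable_indic_itv.
have ib : leb.-integrable setT (EFin \o b).
  exact: integrable_patch (integrable_norm (lh M)).
have iab := integrable_prod ia ib.
have mh : measurable_fun upper (fun p : R * R => h p.2).
  apply: (measurable_comp (F := `[(0:R), +oo[%classic)) => //.
  - by move=> _ [p p0 <-]; rewrite /= in_itv/= andbT ltW.
  - exact: locint_measurable.
  - by apply: measurable_funTS; exact: measurable_snd.
have C0 : 0 <= C by rewrite (le_trans _ (gC (0, 1) _)) ?normr_ge0//= /upper/=.
have D0 : 0 <= D by rewrite (le_trans _ (fD (0, 1))).
apply: (upper_integrable_le _ _ (upper_integrable_scale (C * D) (upper_integrableT iab))).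
  apply: measurable_funM; first exact: measurable_funM.
  by apply: measurable_funTS; exact: continuous_measurable2.
move=> p p0; rewrite !normrM.
have [Mp|] := pselect (M <= `|p.1| \/ M <= `|p.2|).
  rewrite vf// normr0 mulr0 !mulr_ge0//.
  by rewrite /b /patch; case: ifPn => //= _; exact: normr_ge0.
move=> /not_orP[/negP + /negP]; rewrite -!ltNge !ltr_norml => /andP[? ?] /andP[? ?].
rewrite /a indicE mem_set ?mul1r; last by rewrite /= in_itv/= !ltW.
rewrite /b patchE mem_set/=; last by rewrite /= in_itv/= !ltW.
rewrite ?mul1r -mulrA [leRHS]mulrC ler_wpM2l// ler_pM// gC//.
Qed.

End test_functions.

(** * Piecewise smooth functions on the line *)

Section piecewise.
Context {R : realType}.
Local Notation leb := (@lebesgue_measure R).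

(** Used to forget the state on the shock curve itself. *)
Lemma eq_Rintegral_except (c : R) (f g : R -> R) : measurable_fun setT f ->
  measurable_fun setT g -> (forall x, x != c -> f x = g x) ->
  \int[leb]_x f x = \int[leb]_x g x.
Proof.
move=> mf mg fg; rewrite /Rintegral; congr fine.
apply: ae_eq_integral => //.
- exact/measurable_EFinP.
- exact/measurable_EFinP.
- exists [set c]; split => //; first exact: lebesgue_measure_set1.
  by move=> x /= h; apply: contrapT => /eqP xc; apply: h => _; rewrite fg.
Qed.

Lemma FTC_continuous (P p : R -> R) (a b : R) :
  (forall x : R, is_derive x 1 P (p x)) -> continuous p -> a <= b ->
  leb.-integrable `[a, b] (EFin \o p) /\
  \int[leb]_(x in `[a, b]) p x = P b - P a.
Proof.
move=> dP cp ab.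
split.
  apply: continuous_compact_integrable; first exact: segment_compact.
  exact: continuous_subspaceT.
have cP : continuous P.
  by move=> x; apply: differentiable_continuous; apply/derivable1_diffP.
move: ab; rewrite le_eqVlt => /predU1P[->|ab].
  by rewrite set_itv1 Rintegral_set1 subrr.
rewrite /Rintegral (@continuous_FTC2 _ p P)//.
- exact: continuous_subspaceT.
- split => //.
  + by apply: cvg_at_right_filter; exact: cP.
  + by apply: cvg_at_left_filter; exact: cP.
- by move=> x _; rewrite derive1E; exact: derive_val.
Qed.

(** Integration by parts on both sides of a jump at [c]: the boundary terms at
    [c] are all that remains. *)
Lemma piecewise_FTC (P p Q q k : R -> R) (c M : R) :
  (forall x : R, is_derive x 1 P (p x)) -> (forall x : R, is_derive x 1 Q (q x)) ->
  continuous p -> continuous q ->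
  (forall x, x <= - M -> P x = 0) -> (forall x, M <= x -> Q x = 0) ->
  (forall x, x < c -> k x = p x) -> (forall x, c < x -> k x = q x) ->
  (forall x, M <= `|x| -> k x = 0) ->
  leb.-integrable setT (EFin \o k) /\ \int[leb]_x k x = P c - Q c.
Proof.
move=> dP dQ cp cq PM QM kp kq kM.
pose N := `|M| + `|c| + 1.
have MN : M < N by rewrite /N; have := ler_norm M; have := normr_ge0 c; lra.
have /andP[Nc cN] : - N < c < N.
  by rewrite -ltr_norml /N; have := normr_ge0 M; lra.
have [ip Ep] := FTC_continuous dP cp (ltW Nc).
have [iq Eq] := FTC_continuous dQ cq (ltW cN).
(* No assumption is made on [k c], whence the third summand. *)
pose f1 := p \_ `[- N, c[; pose f2 := q \_ `]c, N]; pose f3 := k \_ [set c].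
have mI (i : interval R) : measurable [set` i] by exact: measurable_itv.
have ip' : leb.-integrable `[- N, c[ (EFin \o p).
  by apply: integrableS ip => //; exact: subset_itv_co_cc.
have iq' : leb.-integrable `]c, N] (EFin \o q).
  by apply: integrableS iq => //; exact: subset_itv_oc_cc.
have i1 : leb.-integrable setT (EFin \o f1).
  exact: integrable_patch ip'.
have i2 : leb.-integrable setT (EFin \o f2).
  exact: integrable_patch iq'.
have i3' : leb.-integrable [set c] (EFin \o k).
  apply/integrableP; split; last by rewrite integral_set1.
  apply/measurable_EFinP => _ Y mY.
  have [kY|kY] := pselect (Y (k c)).
    rewrite (_ : _ `&` _ = [set c])//; apply/seteqP; split=> [x []//|x /= ->].
    by split.
  rewrite (_ : _ `&` _ = set0)//; apply/seteqP; split=> [x [/= ->]//|x //].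
have i3 : leb.-integrable setT (EFin \o f3).
  exact: integrable_patch (measurable_set1 c) i3'.
have kE : k = (fun x => f1 x + f2 x + f3 x).
  apply/funext => x; rewrite /f1 /f2 /f3 /patch.
  have -> : (x \in `[- N, c[%classic) = (- N <= x < c).
    by apply/idP/idP; rewrite inE/= in_itv.
  have -> : (x \in `]c, N]%classic) = (c < x <= N).
    by apply/idP/idP; rewrite inE/= in_itv.
  have -> : (x \in [set c]) = (x == c).
    by apply/idP/idP; rewrite inE/= => /eqP.
  have [xc|cx|->] := ltgtP x c.
  - rewrite andbT /= !addr0; case: leP => [Nx|Nx]; first by rewrite kp.
    by rewrite kM// ler0_norm; lra.
  - rewrite andbF /= add0r addr0; case: leP => [Nx|Nx]; first by rewrite kq.
    by rewrite kM// ger0_norm; lra.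
  - by rewrite andbF /= !add0r.
have i12 : leb.-integrable setT (EFin \o (fun x => f1 x + f2 x)).
  by apply: integrable_add.
split; first by rewrite kE; apply: integrable_add.
rewrite kE RintegralD// RintegralD// /f1 /f2 /f3 -!Rintegral_mkcond.
rewrite Rintegral_set1 Rintegral_itv_bndo_bndc// Rintegral_itv_obnd_cbnd//.
have QN : Q N = 0 by apply: QM; exact: ltW.
have PN : P (- N) = 0 by apply: PM; rewrite lerN2 ltW.
by rewrite Ep Eq PN QN subr0 sub0r addr0.
Qed.

(** The three states of a shock, seen from a frame in which it is at rest at
    [0]. *)
Definition states (l m r y : R) : R :=
  if y < 0 then l else if y == 0 then m else r.

Lemma measurable_states l m r : measurable_fun setT (states l m r).
Proof.
apply: measurable_fun_ifT => //; first exact: measurable_fun_ltr.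
by apply: measurable_fun_ifT => //; exact: measurable_fun_eqr.
Qed.

Lemma states_bounded l m r y : `|states l m r y| <= `|l| + `|m| + `|r|.
Proof.
have := normr_ge0 l; have := normr_ge0 m; have := normr_ge0 r.
by rewrite /states; case: ifP => _; [|case: ifP => _]; lra.
Qed.

Lemma states_slice (psi dpsi : R -> R) l m r c M :
  (forall x : R, is_derive x 1 psi (dpsi x)) -> continuous dpsi ->
  (forall x, M <= `|x| -> psi x = 0) -> (forall x, M <= `|x| -> dpsi x = 0) ->
  leb.-integrable setT (EFin \o (fun x => states l m r (x - c) * dpsi x)) /\
  \int[leb]_x (states l m r (x - c) * dpsi x) = (l - r) * psi c.
Proof.
move=> dpsiP cd vpsi vdpsi.
have dZ (a x : R) : is_derive x 1 (fun x => a * psi x) (a * dpsi x).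
  by have := is_deriveZ a (dpsiP x).
have cZ (a : R) : continuous (fun x => a * dpsi x).
  by move=> x; apply: cvgM; [exact: cvg_cst|exact: cd].
have [] := @piecewise_FTC (fun x => l * psi x) (fun x => l * dpsi x)
  (fun x => r * psi x) (fun x => r * dpsi x)
  (fun x => states l m r (x - c) * dpsi x) c M (dZ l) (dZ r) (cZ l) (cZ r).
- move=> x xM; rewrite vpsi ?mulr0//; case: (leP 0 M) => M0.
    by rewrite ler0_norm; lra.
  by rewrite (le_trans (ltW M0)).
- by move=> x xM; rewrite vpsi ?mulr0// (le_trans xM)// ler_norm.
- by move=> x xc; rewrite /states subr_lt0 xc.
- move=> x xc; rewrite /states subr_lt0 ltNge (ltW xc)/= subr_eq0.
  by rewrite gt_eqF.
- by move=> x xM; rewrite vdpsi ?mulr0.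
by move=> ik ->; split => //; ring.
Qed.

Lemma integrable_states l m r (q : R -> R) M : continuous q ->
  (forall x, M <= `|x| -> q x = 0) ->
  leb.-integrable setT (EFin \o (fun x => states l m r x * q x)).
Proof.
move=> cq vq.
have qE : q = q \_ `[- M, M].
  apply/funext => x; rewrite /patch; case: ifPn => //.
  rewrite notin_setE/= in_itv/= => /negP xM; apply: vq.
  by rewrite leNgt; apply: contra xM; rewrite ltr_norml => /andP[? ?]; lra.
have iq : leb.-integrable setT (EFin \o q).
  rewrite qE; apply: integrable_patch; first exact: measurable_itv.
  apply: continuous_compact_integrable; first exact: segment_compact.
  exact: continuous_subspaceT.
have := @integrable_mul_bounded _ _ _ leb setT measurableT q _ _ iq
  (@measurable_states l m r) (fun x _ => states_bounded l m r x).
by apply: eq_integrable_real => // x _; rewrite mulrC.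
Qed.

End piecewise.

(** * Balance laws in a frame that moves with a curve *)

Section along_a_curve.
Context {R : realType}.
Local Notation leb := (@lebesgue_measure R).

Lemma half_line (k : R -> R) (M : R) : (forall t, M <= t -> k t = 0) ->
  leb.-integrable `[0, M] (EFin \o k) ->
  leb.-integrable `]0, +oo[ (EFin \o k) /\
  \int[leb]_(t in `]0, +oo[) k t = \int[leb]_(t in `[0, M]) k t.
Proof.
move=> kM ik.
have iko : leb.-integrable `]0, M] (EFin \o k).
  by apply: integrableS ik => //; exact: subset_itv_oc_cc.
have E : k \_ `]0, +oo[ = k \_ `]0, M].
  apply/funext => t; rewrite /patch.
  have -> : (t \in `]0, +oo[%classic) = (0 < t).
    by apply/idP/idP; rewrite inE/= in_itv/= andbT.
  have -> : (t \in `]0, M]%classic) = (0 < t <= M).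
    by apply/idP/idP; rewrite inE/= in_itv.
  case: ltP => //= t0; case: leP => // Mt; apply: kM; exact: ltW.
split.
  have [_ h] := @integrable_mkcond _ _ _ leb `]0, +oo[%classic (EFin \o k)
    (measurable_itv _).
  apply: h; rewrite restrict_EFin E; exact: integrable_patch.
by rewrite Rintegral_mkcond E -Rintegral_mkcond Rintegral_itv_obnd_cbnd.
Qed.

Variables (X : R -> R) (M : R).
Hypothesis cX : continuous X.

Lemma curve_continuous (f : R * R -> R) y : continuous f ->
  continuous (fun t => f (y + X t, t)).
Proof.
move=> cf t; apply: (@continuous_comp _ _ _ (fun t => (y + X t, t)) f); last exact: cf.
apply: continuous_pair; last exact: cvg_id.
by apply: continuousD; [exact: cvg_cst|exact: cX].
Qed.

Lemma curve_integrable (h : R -> R) (f : R * R -> R) y : locint h ->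
  continuous f -> vanish M f ->
  leb.-integrable `]0, +oo[ (EFin \o (fun t => h t * f (y + X t, t))).
Proof.
move=> lh cf vf.
have [] // := @half_line (fun t => h t * f (y + X t, t)) M.
  by move=> t Mt; rewrite vf ?mulr0//=; right; rewrite (le_trans Mt)// ler_norm.
by apply: locint_mul_continuous => //; exact: curve_continuous.
Qed.

(** Fubini's theorem in the moving frame, where the states no longer depend on
    time. *)
Lemma frame (l m r : R) (F : R * R -> R) :
  leb2.-integrable upper
    (EFin \o (fun p => states l m r (p.1 - X p.2) * F p)) ->
  (forall y, leb.-integrable `]0, +oo[ (EFin \o (fun t => F (y + X t, t)))) ->
  int_upper (fun p => states l m r (p.1 - X p.2) * F p) =
  \int[leb]_y (states l m r y * \int[leb]_(t in `]0, +oo[) F (y + X t, t)).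
Proof.
move=> iF iFy.
have [iS ->] := int_upper_shear (continuous_measurable_fun cX) iF.
rewrite int_upper_xt//; apply: eq_Rintegral => y _.
rewrite -RintegralZl//; apply: eq_Rintegral => t _ /=.
by rewrite /shear/= addrK.
Qed.

End along_a_curve.

Section transport.
Context {R : realType}.
Local Notation leb := (@lebesgue_measure R).
Variables (a g : R -> R) (eta deta : R -> R) (phi : R * R -> R).
Hypothesis la : locint a.
Hypothesis lg : locint g.
Hypothesis deta_cont : continuous deta.
Hypothesis eta_deriv : forall x : R, is_derive x 1 eta (deta x).
Hypothesis tphi : test_closed phi.

(** A test function vanishes at late times, so that only the initial end of the
    curve contributes to the integral of a total derivative. *)
Lemma transport_along_curve (y : R) :
  \int[leb]_(t in `]0, +oo[) (deta (prim a t) * a t * phi (y + prim g t, t) +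
    eta (prim a t) * (dt phi (y + prim g t, t) + g t * dx phi (y + prim g t, t)))
  = - (eta 0 * phi (y, 0)).
Proof.
have [M [M0 [cphi cx ct] [vphi vx vt] dphix dphit]] := test_closed_data tphi.
have CR := chain_rule_primitive la lg deta_cont eta_deriv cphi cx ct dphix dphit
  y (ltW M0).
have CI := chain_rule_integrable la lg deta_cont eta_deriv cphi cx ct y M.
rewrite (half_line _ CI).2; last first.
  move=> t Mt; have Mp : M <= `|y + prim g t| \/ M <= `|t|.
    by right; rewrite (le_trans Mt)// ler_norm.
  by rewrite vphi// vt// vx// !mulr0 addr0 mulr0 addr0.
rewrite -CR vphi; last by right; rewrite /= ler_norm.
by rewrite mulr0 sub0r (prim_le0 a (lexx 0)) (prim_le0 g (lexx 0)) addr0.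
Qed.

End transport.

Section moving_frame.
Context {R : realType}.
Local Notation leb := (@lebesgue_measure R).
Variable g : R -> R.
Hypothesis lg : locint g.
Variable phi : R * R -> R.
Hypothesis tphi : test_closed phi.

Let X := prim g.
Let cX : continuous X. Proof. exact: prim_continuous. Qed.

Lemma measurable_states_frame l m r (D : set (R * R)) :
  measurable_fun D (fun p : R * R => states l m r (p.1 - X p.2)).
Proof.
apply: measurable_funTS.
apply: (@measurableT_comp _ _ _ _ _ _ _ _ (fun p : R * R => p.1 - X p.2)).
  exact: measurable_states.
apply: continuous_measurable2 => p; apply: continuousB; first exact: cvg_fst.
by apply: continuous_comp; [exact: cvg_snd|exact: cX].
Qed.

Lemma integrable_states_frame l m r (h : R -> R) (f : R * R -> R) M :
  locint h -> continuous f -> vanish M f ->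
  leb2.-integrable upper
    (EFin \o (fun p => states l m r (p.1 - X p.2) * (h p.2 * f p))).
Proof.
move=> lh cf vf.
have := @integrable_upper R h (fun p => states l m r (p.1 - X p.2)) f
  (`|l| + `|m| + `|r|) M lh (@measurable_states_frame _ _ _ _)
  (fun p _ => states_bounded _ _ _ _) cf vf.
by apply: upper_eq_integrable => p _; rewrite /=; ring.
Qed.

Section transported.
Variables (a : R -> R) (eta deta : R -> R).
Hypothesis la : locint a.
Hypothesis deta_cont : continuous deta.
Hypothesis eta_deriv : forall x : R, is_derive x 1 eta (deta x).

Let G (p : R * R) := deta (prim a p.2) * a p.2 * phi p +
  eta (prim a p.2) * (dt phi p + g p.2 * dx phi p).

Let eta_cont : continuous eta.
Proof.
by move=> x; apply: differentiable_continuous; apply/derivable1_diffP.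
Qed.

Let ceA (e : R -> R) : continuous e -> continuous (fun t => e (prim a t)).
Proof.
by move=> ce t; apply: continuous_comp; [exact: prim_continuous|exact: ce].
Qed.

Let GE p : G p = a p.2 * deta (prim a p.2) * phi p +
  (eta (prim a p.2) * dt phi p + g p.2 * eta (prim a p.2) * dx phi p).
Proof. by rewrite /G; ring. Qed.

Let lh1 : locint (fun t => a t * deta (prim a t)).
Proof. by apply: locint_mul_continuous => //; exact: ceA. Qed.

Let lh2 : locint (fun t => eta (prim a t)).
Proof. by apply: locint_continuous; exact: ceA. Qed.

Let lh3 : locint (fun t => g t * eta (prim a t)).
Proof. by apply: locint_mul_continuous => //; exact: ceA. Qed.

Lemma integrable_transported l m r : leb2.-integrable upper
  (EFin \o (fun p => states l m r (p.1 - X p.2) * G p)).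
Proof.
have [M [M0 [cphi cx ct] [vphi vx vt] _ _]] := test_closed_data tphi.
have i1 := integrable_states_frame l m r lh1 cphi vphi.
have i2 := integrable_states_frame l m r lh2 ct vt.
have i3 := integrable_states_frame l m r lh3 cx vx.
have := upper_integrable_add i1 (upper_integrable_add i2 i3).
by apply: upper_eq_integrable => p _; rewrite GE /=; ring.
Qed.

(** In the frame that moves with the curve the two states are separated by the
    vertical axis, so that only integrals along translates of the curve are
    left. *)
Lemma int_upper_transported l m r :
  int_upper (fun p => states l m r (p.1 - X p.2) * G p) =
  - (eta 0 * \int[leb]_y (states l m r y * phi (y, 0))).
Proof.
have [M [M0 [cphi cx ct] [vphi vx vt] _ _]] := test_closed_data tphi.
rewrite (frame cX); last 2 first.
- exact: integrable_transported.
- move=> y.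
  have i1 := curve_integrable cX y lh1 cphi vphi.
  have i2 := curve_integrable cX y lh2 ct vt.
  have i3 := curve_integrable cX y lh3 cx vx.
  have := integrable_add _ i1 (integrable_add _ i2 i3).
  move=> /(_ (measurable_itv _) (measurable_itv _)).
  by apply: eq_integrable_real => // t _; rewrite GE.
transitivity (\int[leb]_y (- eta 0 * (states l m r y * phi (y, 0)))).
  apply: eq_Rintegral => y _.
  rewrite (_ : \int[leb]_(t in `]0, +oo[) _ = - (eta 0 * phi (y, 0))); last first.
    exact: (transport_along_curve la lg deta_cont eta_deriv tphi).
  by ring.
rewrite RintegralZl ?mulNr//; apply: (@integrable_states _ _ _ _ _ M).
  move=> x; apply: (@continuous_comp _ _ _ (fun x => (x, 0)) phi); last exact: cphi.
  by apply: continuous_pair; [exact: cvg_id|exact: cvg_cst].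
by move=> x h; apply: vphi; left.
Qed.
End transported.

(** The flux of a piecewise constant density only sees the jump. *)
Lemma int_upper_jump l m r (b : R -> R) : locint b ->
  int_upper (fun p => states l m r (p.1 - X p.2) * (b p.2 * dx phi p)) =
  (l - r) * \int[leb]_(t in `]0, +oo[) (b t * phi (X t, t)).
Proof.
move=> lb.
have [M [M0 [cphi cx ct] [vphi vx vt] dphix _]] := test_closed_data tphi.
rewrite int_upper_tx; last exact: integrable_states_frame lb cx vx.
rewrite -RintegralZl//; last first.
  have := curve_integrable cX 0 lb cphi vphi.
  by apply: eq_integrable_real => // t _; rewrite add0r.
apply: eq_Rintegral => t _ /=.
have vx' x : M <= `|x| -> dx phi (x, t) = 0 by move=> h; apply: vx; left.
have vp' x : M <= `|x| -> phi (x, t) = 0 by move=> h; apply: vphi; left.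
have cxt : continuous (fun x => dx phi (x, t)).
  move=> x; apply: (@continuous_comp _ _ _ (fun x => (x, t)) (dx phi)); last exact: cx.
  by apply: continuous_pair; [exact: cvg_id|exact: cvg_cst].
have [ist Est] := @states_slice _ (fun x => phi (x, t)) _ l m r (X t) M
  (dphix ^~ t) cxt vp' vx'.
transitivity (b t * \int[leb]_x (states l m r (x - X t) * dx phi (x, t))).
  by rewrite -RintegralZl//; apply: eq_Rintegral => x _; ring.
by rewrite Est; ring.
Qed.

End moving_frame.

(** * The delta shock is a weak solution *)

Section delta_shock.
Context {R : realType}.
Local Notation leb := (@lebesgue_measure R).
Variables (alpha sigma : R -> R) (rhom rhop um up : R).
Hypothesis alpha_ge0 : {ae leb, forall t, 0 <= t -> 0 <= alpha t}.
Hypothesis alpha_L1 : leb.-integrable `[0, +oo[ (EFin \o alpha).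
Hypothesis sigma_ge0 : {ae leb, forall t, 0 <= t -> 0 <= sigma t}.
Hypothesis sigma_L1loc : L1_loc sigma.

Local Notation bet := (beta alpha sigma).
Local Notation B := (Bint alpha sigma).
Local Notation X := (shock_position alpha sigma um up).
Local Notation w := (shock_weight alpha sigma rhom rhop um up).

Definition shock_speed (t : R) : R := (um + up) / 2 * bet t.

Let lb : locint bet. Proof. exact: locint_beta. Qed.

Let lsig : locint sigma. Proof. exact: locint_sigma. Qed.

Lemma locint_shock_speed : locint shock_speed.
Proof. exact: locint_scale. Qed.

Lemma shock_positionE : X = prim shock_speed.
Proof. by apply/funext => t; rewrite /shock_speed prim_scale. Qed.

Lemma shock_weightE :
  w = prim (fun t => (rhom + rhop) * (um - up) / 2 * bet t).
Proof. by apply/funext => t; rewrite prim_scale. Qed.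

Lemma shock_position_continuous : continuous X.
Proof. by rewrite shock_positionE; exact: prim_continuous locint_shock_speed. Qed.

Lemma shock_weight_continuous : continuous w.
Proof. by rewrite shock_weightE; apply: prim_continuous; exact: locint_scale. Qed.

Lemma three_statesE l m r (p : R * R) :
  three_states alpha sigma um up l m r p = states l m r (p.1 - X p.2).
Proof. by rewrite /three_states /states subr_lt0 subr_eq0. Qed.

Lemma riemannE (l m r : R) (q : R -> R) M : continuous q ->
  (forall x, M <= `|x| -> q x = 0) ->
  \int[leb]_x (riemann l r x * q x) = \int[leb]_x (states l m r x * q x).
Proof.
move=> cq vq; have mq := continuous_measurable_fun cq.
apply: (@eq_Rintegral_except _ 0).
- apply: measurable_funM => //; apply: measurable_fun_ifT => //.
  exact: measurable_fun_ltr.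
- by apply: measurable_funM => //; exact: measurable_states.
- by move=> x x0; rewrite /riemann /states (negbTE x0).
Qed.

Definition delta_shock : shock_data (R := R) := ShockData `]0, +oo[ X id w
  (three_states alpha sigma um up rhom 0 rhop)
  (fun p => three_states alpha sigma um up um ((um + up) / 2) up p
            * damping sigma p.2)
  (fun s => (um + up) / 2 * damping sigma s).

Section balances.
Variable phi : R * R -> R.
Hypothesis tphi : test_closed phi.

(** The velocity of the frame is the mean of the two velocities.  If [up < um],
    mass then flows in relative to it from both sides, at the rates
    [rhom * (um - up) / 2] and [rhop * (um - up) / 2] times [bet].  These rates
    add up: all this mass accumulates on the curve. *)
Lemma int_upper_mass :
  int_upper (sh_rho delta_shock \* dt phi) +
  int_upper (fun p => alpha p.2 * sh_rho delta_shock p * sh_u delta_shock p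
                      * dx phi p) =
  (rhom + rhop) * (um - up) / 2 * \int[leb]_(t in `]0, +oo[) (bet t * phi (X t, t))
  - \int[leb]_x (riemann rhom rhop x * phi (x, 0)).
Proof.
have [M [M0 [cphi cx ct] [vphi vx vt] _ _]] := test_closed_data tphi.
have lg := locint_shock_speed.
have fr := integrable_states_frame lg.
have c1 : continuous (cst 1 : R -> R) by move=> x; exact: cvg_cst.
have c0 : continuous (cst 0 : R -> R) by move=> x; exact: cvg_cst.
have d1 (x : R) : is_derive x 1 (cst 1 : R -> R) (cst 0 x).
  exact: is_derive_cst.
rewrite -int_upperD; last 2 first.
- have := fr rhom 0 rhop _ _ _ (locint_cst 1) ct vt.
  apply: upper_eq_integrable => p _.
  by rewrite /= three_statesE shock_positionE mul1r.
- have := fr (rhom * um) 0 (rhop * up) _ _ _ lb cx vx.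
  apply: upper_eq_integrable => p _.
  rewrite /= !three_statesE shock_positionE /beta.
  by rewrite /states; case: ifP => _; [|case: ifP => _]; ring.
(* The fluxes relative to the frame, divided by [bet]. *)
pose km := rhom * (um - up) / 2; pose kp := - (rhop * (um - up) / 2).
have T1 := integrable_transported lg tphi (locint_cst 0) c0 d1 rhom 0 rhop.
have E1 := int_upper_transported lg tphi (locint_cst 0) c0 d1 rhom 0 rhop.
have T2 := fr km 0 kp _ _ _ lb cx vx.
have E2 := int_upper_jump lg tphi km 0 kp lb.
have -> : (rhom + rhop) * (um - up) / 2 = km - kp by rewrite /km /kp; ring.
rewrite shock_positionE -E2 (@riemannE _ 0 _ _ M); last 2 first.
- move=> x; apply: (@continuous_comp _ _ _ (fun x => (x, 0)) phi); last exact: cphi.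
  by apply: continuous_pair; [exact: cvg_id|exact: cvg_cst].
- by move=> x h; apply: vphi; left.
rewrite -[X in _ - X]mul1r addrC -E1 -int_upperD//.
apply: eq_int_upper => p _ /=.
rewrite !three_statesE shock_positionE /shock_speed /km /kp /beta.
by rewrite /states; case: ifP => _; [|case: ifP => _]; field.
Qed.

(** On the curve [alpha * u] is the speed of the shock.  Hence the delta part is
    carried along the curve and only the growth of [w] remains. *)
Lemma weighted_delta_mass :
  weighted_delta `]0, +oo[ X id w (dt phi) +
  weighted_delta `]0, +oo[ X id (flux_weight alpha delta_shock) (dx phi) =
  - ((rhom + rhop) * (um - up) / 2 *
     \int[leb]_(t in `]0, +oo[) (bet t * phi (X t, t))).
Proof.
have [M [M0 [cphi cx ct] [vphi vx vt] _ _]] := test_closed_data tphi.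
have lg := locint_shock_speed.
have cX : continuous (prim shock_speed) by exact: prim_continuous.
have cw := shock_weight_continuous.
pose c := (rhom + rhop) * (um - up) / 2.
have lcb : locint (fun t => c * bet t) by exact: locint_scale.
have d1 (x : R) : is_derive x 1 (id : R -> R) (cst 1 x) by exact: is_derive_id.
have c1 : continuous (cst 1 : R -> R) by move=> x; exact: cvg_cst.
have := transport_along_curve lcb lg c1 d1 tphi 0.
rewrite mul0r oppr0 -shock_weightE -shock_positionE => E0.
have curve h f : locint h -> continuous f -> vanish M f ->
    leb.-integrable `]0, +oo[ (EFin \o (fun t => h t * f (X t, t))).
  move=> lh cf vf; have := curve_integrable cX 0 lh cf vf.
  by apply: eq_integrable_real => // t _; rewrite add0r shock_positionE.
have i1 := curve _ _ lb cphi vphi.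
have i2 := curve _ _ (locint_continuous cw) ct vt.
have i3 := curve _ _ (locint_mul_continuous lg cw) cx vx.
rewrite -RintegralZl// -[RHS]add0r -[X in _ = X + _]E0 -RintegralB//; last 2 first.
- have := integrable_add _ (integrable_scale _ c i1) (integrable_add _ i2 i3).
  move=> /(_ (measurable_itv _) (measurable_itv _) (measurable_itv _)).
  by apply: eq_integrable_real => // t _; rewrite add0r /=; ring.
- exact: integrable_scale.
have i3' : leb.-integrable `]0, +oo[
    (EFin \o (fun t => flux_weight alpha delta_shock t * dx phi (X t, t))).
  apply: eq_integrable_real i3; first exact: measurable_itv.
  by move=> t _ /=; rewrite /flux_weight/= /shock_speed /beta; ring.
rewrite /weighted_delta -(RintegralD _ i2 i3'); last exact: measurable_itv.
apply: eq_Rintegral => t _ /=.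
by rewrite /flux_weight/= /shock_speed /beta /c add0r /=; ring.
Qed.

Lemma rho_balance :
  pair_rho delta_shock (dt phi) + pair_flux alpha delta_shock (dx phi)
  + \int[leb]_x (riemann rhom rhop x * phi (x, 0)) = 0.
Proof.
have E1 := int_upper_mass; have E2 := weighted_delta_mass.
rewrite /pair_rho /pair_flux.
by rewrite addrACA E1 E2; ring.
Qed.

(** The damping is the choice [eta = fun x => exp (- x)] in the product rule,
    whose derivative gives back the source term [- sigma * u]. *)
Lemma u_balance_shock :
  u_balance alpha sigma (sh_u delta_shock) phi
  + \int[leb]_x (riemann um up x * phi (x, 0)) = 0.
Proof.
have [M [M0 [cphi cx ct] [vphi vx vt] _ _]] := test_closed_data tphi.
have lg := locint_shock_speed.
pose deta (x : R) := - expR (- x).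
have cdeta : continuous deta.
  move=> x; apply: cvgN.
  by apply: continuous_comp; [exact: opp_continuous|exact: continuous_expR].
have d1 (x : R) : is_derive x 1 (fun x => expR (- x)) (deta x).
  by rewrite /deta; apply: is_derive_eq; rewrite mulrN1.
have T1 := integrable_transported lg tphi lsig cdeta d1 um ((um + up) / 2) up.
have E1 := int_upper_transported lg tphi lsig cdeta d1 um ((um + up) / 2) up.
(* [k] is [v ^+ 2 / 2 - (um + up) / 2 * v] both at [v = um] and at [v = up]; [km] is
   its value at the mean. *)
pose k := - (um * up) / 2; pose km := - ((um + up) / 2) ^+ 2 / 2.
have lbd : locint (fun t => bet t * damping sigma t).
  by apply: locint_mul_continuous => //; exact: damping_continuous.
have T2 := integrable_states_frame lg k km k lbd cx vx.
have := int_upper_jump lg tphi k km k lbd.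
rewrite subrr mul0r => E2.
rewrite /u_balance (@riemannE _ ((um + up) / 2) _ _ M); last 2 first.
- move=> x; apply: (@continuous_comp _ _ _ (fun x => (x, 0)) phi); last exact: cphi.
  by apply: continuous_pair; [exact: cvg_id|exact: cvg_cst].
- by move=> x h; apply: vphi; left.
move: E1; rewrite oppr0 expR0 mul1r => E1.
rewrite -[RHS](addNr (\int[leb]_x (states um ((um + up) / 2) up x * phi (x, 0)))).
congr (_ + _); rewrite -E1 -[RHS]addr0 -E2 -int_upperD//.
apply: eq_int_upper => p _ /=.
rewrite !three_statesE shock_positionE /shock_speed /k /km /beta.
rewrite -/(damping sigma p.2) /deta.
rewrite (_ : expR (- prim sigma p.2) = damping sigma p.2)//.
by rewrite /states; case: ifP => _; [|case: ifP => _]; field.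
Qed.

End balances.

End delta_shock.

Section bounded_plane.
Context {R : realType}.

Lemma Linfty_upper_bounded (f : R * R -> R) (C : R) : measurable_fun upper f ->
  (forall p, upper p -> `|f p| <= C) -> Linfty_upper f.
Proof.
move=> mf fC; split => //; rewrite /finite_norm unlock /Lnorm.
case: ifP => // _; apply: (@le_lt_trans _ _ `|C|%:E); last exact: ltry.
apply/ess_supP; apply: aeW => p /=; rewrite lee_fin /patch.
case: ifPn => [|_]; last by rewrite normr0.
by rewrite inE => /fC h; rewrite (le_trans h)// ler_norm.
Qed.

End bounded_plane.

Section delta_shock_solution.
Context {R : realType}.
Local Notation leb := (@lebesgue_measure R).
Variables (alpha sigma : R -> R) (rhom rhop um up : R).
Hypothesis alpha_ge0 : {ae leb, forall t, 0 <= t -> 0 <= alpha t}.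
Hypothesis alpha_L1 : leb.-integrable `[0, +oo[ (EFin \o alpha).
Hypothesis sigma_ge0 : {ae leb, forall t, 0 <= t -> 0 <= sigma t}.
Hypothesis sigma_L1loc : L1_loc sigma.

Local Notation X := (shock_position alpha sigma um up).
Local Notation w := (shock_weight alpha sigma rhom rhop um up).
Local Notation D := (delta_shock alpha sigma rhom rhop um up).

Let cX : continuous X. Proof. exact: shock_position_continuous. Qed.

Lemma measurable_three_states l m r (A : set (R * R)) :
  measurable_fun A (three_states alpha sigma um up l m r).
Proof.
have ls := locint_shock_speed um up alpha_L1 sigma_ge0 sigma_L1loc.
have := @measurable_states_frame R _ ls l m r A.
congr (measurable_fun _ _); apply/funext => p.
by rewrite three_statesE shock_positionE.
Qed.

Lemma curve_integrable_along (h : R -> R) : locint h ->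
  integrable_along `]0, +oo[ X id h.
Proof.
move=> lh K cK KU.
have [N KN] : exists N, forall p, K p -> `|p.2| <= N.
  have [C [_ CP]] := compact_bounded cK; exists (`|C| + 1) => p Kp.
  have : `|p| <= `|C| + 1.
    by apply: CP => //; rewrite ltr_pwDr// ler_norm.
  by rewrite prod_normE ge_max => /andP[].
apply: integrableS (lh N).
- exact: measurable_itv.
- apply: measurableI; first exact: measurable_itv.
  apply: closed_measurable.
  rewrite (_ : [set s | _] = (fun s => (X s, s)) @^-1` K)//.
  apply: closed_comp.
    by move=> s _; apply: continuous_pair; [exact: cX|exact: cvg_id].
  apply: compact_closed => //; exact: (@norm_hausdorff R (R * R)%type).
- move=> s [/=]; rewrite !in_itv/= andbT => s0 /KN/= sN.
  by rewrite ltW//= (le_trans _ sN)// ler_norm.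
Qed.

Lemma delta_shock_wf : shock_data_wf alpha D.
Proof.
have ls := locint_shock_speed um up alpha_L1 sigma_ge0 sigma_L1loc.
have cw : continuous w by exact: shock_weight_continuous.
have d1 t : `|damping sigma t| <= 1.
  by rewrite ger0_norm ?damping_le1// ltW// damping_gt0.
split => /=.
- split; first by exists 1; rewrite /= in_itv/= ltr01.
  exact: interval_open.
- split.
    exists (shock_speed alpha sigma um up) => a b; rewrite !in_itv/= !andbT.
    move=> a0 b0 ab; split; first by apply: locintS => //; exact: ltW.
    rewrite shock_positionE//; apply: prim_sub => //; exact: ltW.
  exists (cst 1) => a b _ _ ab; split.
    apply: continuous_compact_integrable; first exact: segment_compact.
    by apply: continuous_subspaceT => x; exact: cvg_cst.
  rewrite Rintegral_cst//= lebesgue_measure_itv/= lte_fin.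
  by case: ltP => /= h; rewrite mul1r//; lra.
- split; first by apply: curve_integrable_along; exact: locint_continuous.
  apply: curve_integrable_along.
  rewrite (_ : flux_weight _ _ = fun t => shock_speed alpha sigma um up t * w t).
    exact: locint_mul_continuous.
  by apply/funext => t; rewrite /flux_weight/= /shock_speed /beta; ring.
- split.
    apply: Linfty_upper_bounded; first exact: measurable_three_states.
    by move=> p _; rewrite three_statesE; exact: states_bounded.
  apply: (@Linfty_upper_bounded _ _ (`|um| + `|(um + up) / 2| + `|up|)).
    apply: measurable_funM; first exact: measurable_three_states.
    apply: measurable_funTS; apply: measurableT_comp measurable_snd.
    exact: continuous_measurable_fun (damping_continuous sigma_L1loc).
  move=> p _; rewrite normrM three_statesE -[leRHS]mulr1.
  by apply: ler_pM => //; exact: states_bounded.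
- move=> s; rewrite in_itv/= andbT => s0; split; first exact: ltW.
  by rewrite /three_states /= ltxx eqxx.
Qed.

(** The trace at [t = 0] vanishes, so the weak equations are the case without
    boundary term of the identities that express the initial data. *)
Lemma test_open_closed (phi : R * R -> R) : test_open phi ->
  test_closed phi /\ forall x, phi (x, 0) = 0.
Proof.
move=> [sm cs su]; split => // x; apply: contrapT => /eqP h.
have /su : supp phi (x, 0) by apply: subset_closure.
by rewrite /upper/= ltxx.
Qed.

Lemma delta_shock_initial : attains_initial_data alpha sigma D
  (riemann rhom rhop) (riemann um up).
Proof. by move=> phi tphi; split; [exact: rho_balance|exact: u_balance_shock]. Qed.

Lemma delta_shock_weak : weak_equations alpha sigma D.
Proof.
move=> phi /test_open_closed[tphi phi0].
have [] := delta_shock_initial tphi.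
have z (q : R -> R) : \int[leb]_x (q x * phi (x, 0)) = 0.
  under eq_Rintegral do rewrite phi0 mulr0.
  by rewrite Rintegral_cst// mul0r.
by rewrite !z !addr0.
Qed.

End delta_shock_solution.

(** * The Gaussian tail and the heat integrals *)

Section gauss_tail.
Context {R : realType}.
Local Notation leb := (@lebesgue_measure R).
Local Notation spi := (Num.sqrt (pi : R)).

Definition gauss_cdf (z : R) : R := \int[leb]_(s in `]-oo, z]) gauss_fun s.

Lemma integrable_gauss (A : set R) : measurable A ->
  leb.-integrable A (EFin \o @gauss_fun R).
Proof.
by move=> mA; apply: integrableS (@integrableT_gauss R) => //.
Qed.

Lemma is_derive_gauss_cdf (z : R) : is_derive z 1 gauss_cdf (gauss_fun z).
Proof.
have [] := @continuous_FTC1 R (@gauss_fun R) -oo%O z (z + 1).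
- by rewrite ltrDl.
- by apply: integrable_gauss; exact: measurable_itv.
- by rewrite ltNyr.
- exact: continuous_gauss_fun.
by move=> d e; constructor; [exact: d|rewrite -derive1E; exact: e].
Qed.

Lemma gauss_cdf_ge0 z : 0 <= gauss_cdf z.
Proof. by apply: Rintegral_ge0 => x _; exact: gauss_fun_ge0. Qed.

Lemma gauss_cdf_gt0 z : 0 < gauss_cdf z.
Proof.
have [] := @MVT R gauss_cdf gauss_fun (z - 1) z.
- by rewrite ltrBlDr ltrDl.
- by move=> x _; exact: is_derive_gauss_cdf.
- apply: continuous_subspaceT => x; apply: differentiable_continuous.
  by apply/derivable1_diffP; have [] := is_derive_gauss_cdf x.
move=> c _ E; have := gauss_cdf_ge0 (z - 1).
have : 0 < gauss_fun c by exact: expR_gt0.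
by move: E; rewrite opprB addrCA subrr addr0 mulr1; lra.
Qed.

Lemma le_gauss_cdf : {homo gauss_cdf : x y / x <= y}.
Proof.
move=> x y xy; rewrite /gauss_cdf /Rintegral fine_le//.
- exact: integrable_fin_num (integrable_gauss (measurable_itv _)).
- exact: integrable_fin_num (integrable_gauss (measurable_itv _)).
apply: ge0_subset_integral => //.
- by apply/measurable_EFinP; apply: measurable_funTS; exact: measurable_gauss_fun.
- by move=> z _; rewrite lee_fin gauss_fun_ge0.
- by apply: subset_itvl; rewrite bnd_simp.
Qed.

Lemma gauss_cdf_le z : gauss_cdf z <= spi.
Proof.
rewrite -lee_fin -integralT_gauss /gauss_cdf /Rintegral fineK; last first.
  exact: integrable_fin_num (integrable_gauss (measurable_itv _)).
apply: ge0_subset_integral => //.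
- by apply/measurable_EFinP; exact: measurable_gauss_fun.
- by move=> x _; rewrite lee_fin gauss_fun_ge0.
Qed.

Lemma gauss_cdf0 : gauss_cdf 0 = spi / 2.
Proof.
rewrite /gauss_cdf /Rintegral.
transitivity (fine (\int[leb]_(s in `[0%R, +oo[) (gauss_fun s)%:E)%E).
  congr fine; rewrite ge0_integration_by_substitution0; last 2 first.
  - by apply/measurable_EFinP; exact: measurable_gauss_fun.
  - by move=> x; rewrite lee_fin gauss_fun_ge0.
  by apply: eq_integral => x _; rewrite /gauss_fun sqrrN.
by rewrite [X in fine X]integral0y_gauss.
Qed.

Lemma gauss_cdf_ge z : 0 <= z -> spi / 2 <= gauss_cdf z.
Proof. by move=> z0; rewrite -gauss_cdf0; exact: le_gauss_cdf. Qed.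

(** The scaled complementary error function at [- z], up to a factor: the growth
    [exp (z^2)] compensates the decay of the Gaussian tail at [-oo]. *)
Definition mills (z : R) : R := expR (z ^+ 2) * gauss_cdf z.

Lemma mills_gt0 z : 0 < mills z.
Proof. by rewrite mulr_gt0 ?expR_gt0 ?gauss_cdf_gt0. Qed.

Lemma mills_le z : mills z <= spi * expR (z ^+ 2).
Proof. by rewrite /mills mulrC ler_wpM2r ?expR_ge0// gauss_cdf_le. Qed.

Lemma mills_ge z : 0 <= z -> spi / 2 * expR (z ^+ 2) <= mills z.
Proof.
by move=> z0; rewrite /mills [leRHS]mulrC ler_wpM2r ?expR_ge0// gauss_cdf_ge.
Qed.

Lemma is_derive_mills (z : R) : is_derive z 1 mills (2 * z * mills z + 1).
Proof.
have dsq : is_derive z 1 (fun z : R => z * z) (1 * z + z * 1).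
  by apply: derive_mul; exact: derive_id_fun.
have dexp := @derive_comp R expR (fun z => z * z) z _ _ (is_derive_expR _) dsq.
have := derive_mul dexp (is_derive_gauss_cdf z).
rewrite /mills => /derive_eq; apply.
rewrite /gauss_fun expr2 -expRD addrN expR0; ring.
Qed.

Lemma mills_continuous : continuous mills.
Proof.
exact: derive_continuous is_derive_mills.
Qed.

(** Change of variable [s = y / k + c]. *)
Lemma integral_gauss_affine (k c : R) : 0 < k ->
  (\int[leb]_(y in `]-oo, 0%R]) (gauss_fun (y / k + c))%:E
   = (k * gauss_cdf c)%:E)%E.
Proof.
move=> k0; pose F y := y / k + c.
have dF (x : R) : is_derive x 1 F k^-1.
  rewrite /F; under eq_fun do rewrite mulrC.
  have := derive_add (derive_scale k^-1 (derive_id_fun x)) (derive_cst_fun c x).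
  by move=> /derive_eq; apply; rewrite mulr1 addr0.
have F' : derive1 F = cst k^-1.
  by apply/funext => x; rewrite derive1E; exact: derive_val.
have F0 : F 0 = c by rewrite /F mul0r add0r.
have := @increasing_ge0_integration_by_substitutionNy R F (@gauss_fun R) 0.
rewrite F0 F' => S.
have cF : continuous F.
  exact: derive_continuous dF.
transitivity (k%:E * \int[leb]_(x in `]-oo, 0%R]) (((gauss_fun \o F) * cst k^-1) x)%:E)%E.
  rewrite -ge0_integralZl//.
  - apply: eq_integral => y _; rewrite -EFinM; congr EFin.
    rewrite [(_ * _) y](_ : _ = gauss_fun (y / k + c) * k^-1)//.
    by rewrite mulrCA mulfV ?mulr1// gt_eqF.
  - apply/measurable_EFinP; apply: measurable_funTS.
    apply: measurable_funM => //.
    apply: measurableT_comp; first exact: measurable_gauss_fun.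
    exact: continuous_measurable_fun.
  - by move=> y _; rewrite lee_fin mulr_ge0// ?gauss_fun_ge0// invr_ge0 ltW.
  - by rewrite lee_fin ltW.
rewrite -S//.
- rewrite EFinM /gauss_cdf /Rintegral fineK//.
  exact: integrable_fin_num (integrable_gauss (measurable_itv _)).
- by move=> x y _ _ xy; rewrite /F ltrD2r ltr_pM2r ?invr_gt0.
- by move=> x _; exact: cvg_cst.
- exact: is_cvg_cst.
- exact: cvg_cst.
- split; first by move=> x _; case: (dF x).
  by apply: cvg_at_left_filter; exact: cF.
- apply/cvgrNyPle => A; near=> x.
  rewrite /F -lerBrDr ler_pdivrMr//; near: x; exact: nbhs_ninfty_le.
- exact: continuous_subspaceT continuous_gauss_fun.
- by move=> x _; exact: gauss_fun_ge0.
Unshelve. all: by end_near. Qed.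

End gauss_tail.

Section heat_integrals.
Context {R : realType}.
Local Notation leb := (@lebesgue_measure R).
Variables (alpha sigma : R -> R) (eps t : R).
Local Notation B := (Bint alpha sigma).
Hypothesis eps_gt0 : 0 < eps.
Hypothesis Bt_gt0 : 0 < B t.

Let k := Num.sqrt (4 * eps * B t).

Let k_gt0 : 0 < k. Proof. by rewrite sqrtr_gt0 !mulr_gt0. Qed.

Let kk : k ^+ 2 = 4 * eps * B t.
Proof. by rewrite sqr_sqrtr// !mulr_ge0// ltW. Qed.

Lemma heat_integral_neg v x :
  \int[leb]_(y in `]-oo, 0]) heat_integrand alpha sigma eps v x t y =
  k * expR (- (x ^+ 2 / k ^+ 2)) * mills (- (x - v * B t) / k).
Proof.
pose z := - (x - v * B t) / k.
transitivity (fine (\int[leb]_(y in `]-oo, 0%R])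
    ((expR (- (x ^+ 2 / k ^+ 2) + z ^+ 2))%:E * (gauss_fun (y / k + z))%:E))%E).
  congr fine; apply: eq_integral => y _; rewrite -EFinM; congr EFin.
  rewrite /heat_integrand /gauss_fun -expRD; congr expR.
  have -> : 4 * eps * B t = k ^+ 2 by [].
  have -> : v * y / (2 * eps) = 2 * v * y * B t / k ^+ 2.
    by rewrite kk; field; rewrite !gt_eqF.
  by rewrite /z; field; rewrite gt_eqF.
rewrite ge0_integralZl//; last 2 first.
- apply/measurable_EFinP; apply: measurable_funTS.
  apply: measurableT_comp; first exact: measurable_gauss_fun.
  by apply: measurable_funD => //; apply: measurable_funM.
- by move=> y _; rewrite lee_fin gauss_fun_ge0.
rewrite integral_gauss_affine// -EFinM /= expRD /mills -/z; ring.
Qed.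

Lemma heat_integral_pos v x :
  \int[leb]_(y in `[0, +oo[) heat_integrand alpha sigma eps v x t y =
  k * expR (- (x ^+ 2 / k ^+ 2)) * mills ((x - v * B t) / k).
Proof.
transitivity (\int[leb]_(y in `]-oo, 0]) heat_integrand alpha sigma eps (- v) (- x) t y).
  rewrite /Rintegral ge0_integration_by_substitution0; last 2 first.
  - apply/measurable_EFinP; apply: measurableT_comp => //.
    apply: measurable_funB; last first.
      by apply: measurable_funM => //; exact: measurable_funM.
    apply: measurableT_comp => //; apply: measurable_funM => //.
    by apply: measurable_funX; exact: measurable_funB.
  - by move=> y; rewrite lee_fin expR_ge0.
  congr fine; apply: eq_integral => y _; congr EFin; rewrite /heat_integrand.
  by congr expR; congr (- (_ / _) - _); ring.
rewrite heat_integral_neg sqrrN; congr (_ * mills _).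
by congr (_ / _); ring.
Qed.

End heat_integrals.

(** * The viscous profiles and their decay *)

Section profiles.
Context {R : realType}.
Variables (rhom rhop um up : R).
Hypothesis u_gt : up < um.
Implicit Types eps x tau : R.

(** The length scale of diffusion when [tau] is the value of [Bint]; the arguments
    of [mills] below are signed distances to the fronts [x = um * tau] and
    [x = up * tau] in this unit. *)
Definition width eps tau : R := Num.sqrt (4 * eps * tau).
Definition zright eps x tau : R := (x - up * tau) / width eps tau.
Definition zleft eps x tau : R := - (x - um * tau) / width eps tau.
Definition total eps x tau : R :=
  mills (zright eps x tau) + mills (zleft eps x tau).
(** The weights with which the right and the left state enter the viscous
    solution. *)
Definition pright eps x tau : R := mills (zright eps x tau) / total eps x tau.
Definition pleft eps x tau : R := mills (zleft eps x tau) / total eps x tau.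

(** [Wvisc] after division of numerator and denominator by the common factor of
    [bplus] and [bminus]. *)
Definition Wprofile eps x tau : R :=
  width eps tau * (rhop * (zright eps x tau * mills (zright eps x tau) + 1 / 2) -
    rhom * (zleft eps x tau * mills (zleft eps x tau) + 1 / 2)) / total eps x tau.

(** The derivative of [Wprofile], arranged so that [zleft] and [zright], which are large
    when [width] is small, enter only with the small factor [zright + zleft]. *)
Definition rho_profile eps x tau : R :=
  rhom * pleft eps x tau + rhop * pright eps x tau +
  (zright eps x tau + zleft eps x tau) *
    (rhom * pright eps x tau + rhop * pleft eps x tau) / total eps x tau +
  2 * (zright eps x tau + zleft eps x tau) * (pleft eps x tau * pright eps x tau) *
    (rhom * zleft eps x tau + rhop * zright eps x tau).

Lemma total_gt0 eps x tau : 0 < total eps x tau.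
Proof. by rewrite addr_gt0// mills_gt0. Qed.

Lemma pright_ge0 eps x tau : 0 <= pright eps x tau.
Proof. by rewrite divr_ge0 ?ltW ?mills_gt0 ?total_gt0. Qed.

Lemma pleft_ge0 eps x tau : 0 <= pleft eps x tau.
Proof. by rewrite divr_ge0 ?ltW ?mills_gt0 ?total_gt0. Qed.

Lemma pleftD eps x tau : pleft eps x tau + pright eps x tau = 1.
Proof. by rewrite -mulrDl addrC mulfV// gt_eqF// total_gt0. Qed.

Section fixed_time.
Variables eps tau : R.
Hypothesis eps_gt0 : 0 < eps.
Hypothesis tau_gt0 : 0 < tau.

Let k := width eps tau.

Lemma width_gt0 : 0 < k. Proof. by rewrite sqrtr_gt0 !mulr_gt0. Qed.

Lemma width_sqr : k ^+ 2 = 4 * eps * tau.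
Proof. by rewrite sqr_sqrtr// !mulr_ge0// ltW. Qed.

Lemma zrightDleft x : zright eps x tau + zleft eps x tau = (um - up) * tau / k.
Proof. by rewrite /zright /zleft -/k; field; rewrite gt_eqF// width_gt0. Qed.

Lemma zrightBleft x : zright eps x tau - zleft eps x tau =
  2 * (x - (um + up) / 2 * tau) / k.
Proof. by rewrite /zright /zleft -/k; field; rewrite gt_eqF// width_gt0. Qed.

Lemma is_derive_Wprofile x :
  is_derive x 1 (Wprofile eps ^~ tau) (rho_profile eps x tau).
Proof.
have k0 := width_gt0.
have dr : is_derive x 1 (zright eps ^~ tau) (1 / k).
  rewrite /zright; under eq_fun do rewrite mulrC.
  have := derive_scale k^-1 (derive_sub (derive_id_fun x) (derive_cst_fun (up * tau) x)).
  by move=> /derive_eq; apply; rewrite subr0 mulr1 mul1r.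
have dl : is_derive x 1 (zleft eps ^~ tau) (- 1 / k).
  rewrite /zleft; under eq_fun do rewrite mulNr mulrC -mulNr.
  have := derive_scale (- k^-1) (derive_sub (derive_id_fun x) (derive_cst_fun (um * tau) x)).
  by move=> /derive_eq; apply; rewrite subr0 mulr1 mulN1r.
have dMr := @derive_comp R mills (zright eps ^~ tau) x _ _ (is_derive_mills _) dr.
have dMl := @derive_comp R mills (zleft eps ^~ tau) x _ _ (is_derive_mills _) dl.
have dS := derive_add dMr dMl.
have S0 := total_gt0 eps x tau.
have dSV := @derive_inv R (total eps ^~ tau) x _ (lt0r_neq0 S0) dS.
have dNr := derive_scale rhop (derive_add (derive_mul dr dMr) (derive_cst_fun (1 / 2) x)).
have dNl := derive_scale rhom (derive_add (derive_mul dl dMl) (derive_cst_fun (1 / 2) x)).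
have := derive_mul (derive_scale k (derive_sub dNr dNl)) dSV.
rewrite /Wprofile -/k => /derive_eq; apply.
rewrite /rho_profile /pleft /pright.
move: S0; rewrite /total => S0.
set P := mills (zright eps x tau) in S0 *.
set Q := mills (zleft eps x tau) in S0 *.
by field; rewrite !gt_eqF.
Qed.

End fixed_time.

End profiles.

Section viscous_formulas.
Context {R : realType}.
Variables (alpha sigma : R -> R) (rhom rhop um up eps t : R).
Local Notation B := (Bint alpha sigma).
Hypothesis eps_gt0 : 0 < eps.
Hypothesis Bt_gt0 : 0 < B t.

Let k := width eps (B t).
Let k_gt0 : 0 < k. Proof. exact: width_gt0. Qed.
Let K x := expR (- (x ^+ 2 / k ^+ 2)).

Let sqrtE : Num.sqrt (4 * pi * eps * B t) = Num.sqrt pi * k.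
Proof.
rewrite /k /width -sqrtrM ?pi_ge0//; congr Num.sqrt; ring.
Qed.

Let spi_gt0 : 0 < Num.sqrt (pi : R). Proof. by rewrite sqrtr_gt0 pi_gt0. Qed.

Lemma bplusE x :
  bplus alpha sigma up eps x t = K x * mills (zright up eps x (B t)) / Num.sqrt pi.
Proof.
rewrite /bplus sqrtE heat_integral_pos// -/(width _ _) -/k /K /zright -/k.
by field; rewrite !gt_eqF.
Qed.

Lemma bminusE x :
  bminus alpha sigma um eps x t = K x * mills (zleft um eps x (B t)) / Num.sqrt pi.
Proof.
rewrite /bminus sqrtE heat_integral_neg// -/(width _ _) -/k /K /zleft -/k.
by field; rewrite !gt_eqF.
Qed.

Let K_gt0 x : 0 < K x. Proof. exact: expR_gt0. Qed.

Lemma WviscE x : Wvisc alpha sigma rhom rhop um up eps x t =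
  Wprofile rhom rhop um up eps x (B t).
Proof.
rewrite /Wvisc bplusE bminusE /Wprofile -/k.
have -> : Num.sqrt (eps * B t) = k / 2.
  rewrite /k /width (_ : 4 * eps * B t = 2 ^+ 2 * (eps * B t)); last by ring.
  by rewrite [in RHS]sqrtrM ?sqr_ge0// sqrtr_sqr ger0_norm//; field.
have -> : 4 * eps * B t = k ^+ 2 by rewrite width_sqr.
rewrite -/(K x).
have -> : x - um * B t = - (k * zleft um eps x (B t)).
  by rewrite /zleft -/k; field; rewrite gt_eqF.
have -> : x - up * B t = k * zright up eps x (B t).
  by rewrite /zright -/k; field; rewrite gt_eqF.
have := total_gt0 um up eps x (B t); rewrite /total.
set P := mills (zright up eps x (B t)).
set Q := mills (zleft um eps x (B t)) => S0.
have P0 : 0 < P by exact: mills_gt0.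
have Q0 : 0 < Q by exact: mills_gt0.
by field; rewrite !gt_eqF// -?mulrDr ?mulr_gt0// addrC.
Qed.

Lemma rho_viscE x : rho_visc alpha sigma rhom rhop um up eps (x, t) =
  rho_profile rhom rhop um up eps x (B t).
Proof.
rewrite /rho_visc /= gt_eqF//.
rewrite (_ : (fun y => _) = (Wprofile rhom rhop um up eps ^~ (B t))); last first.
  by apply/funext => y; rewrite WviscE.
rewrite derive1E; have := is_derive_Wprofile rhom rhop um up eps_gt0 Bt_gt0 x.
by move=> d; exact: derive_val.
Qed.

Lemma u_viscE x : u_visc alpha sigma um up eps (x, t) =
  (up * pright um up eps x (B t) + um * pleft um up eps x (B t)) * damping sigma t.
Proof.
rewrite /u_visc gt_eqF// bplusE bminusE; congr (_ * _).
rewrite /pright /pleft.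
have := total_gt0 um up eps x (B t); rewrite /total.
set P := mills (zright up eps x (B t)).
set Q := mills (zleft um eps x (B t)) => S0.
have P0 : 0 < P by exact: mills_gt0.
have Q0 : 0 < Q by exact: mills_gt0.
have K0 := K_gt0 x.
by field; rewrite !gt_eqF// -?mulrDr ?mulr_gt0.
Qed.

End viscous_formulas.

Section profile_estimates.
Context {R : realType}.
Variables (rhom rhop um up : R).
Hypothesis rhom_gt0 : 0 < rhom.
Hypothesis rhop_gt0 : 0 < rhop.
Hypothesis u_gt : up < um.
Local Notation spi := (Num.sqrt (pi : R)).
Local Notation pleft := (pleft um up).
Local Notation pright := (pright um up).
Local Notation total := (total um up).

Let spi_gt0 : 0 < spi. Proof. by rewrite sqrtr_gt0 pi_gt0. Qed.

Section estimates.
Variables eps x tau : R.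
Hypothesis eps_gt0 : 0 < eps.
Hypothesis tau_gt0 : 0 < tau.

Let k := width eps tau.
Let a := zright up eps x tau.
Let b := zleft um eps x tau.
Let k_gt0 : 0 < k. Proof. exact: width_gt0. Qed.

Let ab_ge0 : 0 <= a + b.
Proof.
rewrite zrightDleft// divr_ge0 ?ltW// mulr_gt0// subr_gt0//.
Qed.

(** As [up < um], the two arguments of [mills] have a nonnegative sum, hence one
    of them is nonnegative, and [mills] is at least [spi / 2] there. *)
Lemma total_ge : spi / 2 <= total eps x tau.
Proof.
have half z : 0 <= z -> spi / 2 <= mills z.
  move=> z0; apply: le_trans (mills_ge z0); rewrite ler_pMr ?divr_gt0//.
  by rewrite -expR0 ler_expR sqr_ge0.
rewrite /total -/a -/b.
have [a0|a0] := leP 0 a.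
  by apply: (le_trans (half _ a0)); rewrite lerDl ltW// mills_gt0.
have b0 : 0 <= b by have := ab_ge0; lra.
by apply: (le_trans (half _ b0)); rewrite lerDr ltW// mills_gt0.
Qed.

Lemma inv_total_le : (total eps x tau)^-1 <= 2 / spi.
Proof.
rewrite -[2 / spi]invrK invf_div lef_pV2 ?posrE ?total_ge ?total_gt0//.
by rewrite divr_gt0.
Qed.

Lemma pleft_le1 : pleft eps x tau <= 1.
Proof.
by rewrite -(pleftD um up eps x tau) lerDl pright_ge0.
Qed.

Lemma pright_le1 : pright eps x tau <= 1.
Proof.
by rewrite -(pleftD um up eps x tau) lerDr pleft_ge0.
Qed.

Let mills_ratio (y z : R) : 0 <= y -> mills z / mills y <= 2 * expR (z ^+ 2 - y ^+ 2).
Proof.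
move=> y0; rewrite ler_pdivrMr ?mills_gt0//.
apply: (le_trans (mills_le z)).
have -> : spi * expR (z ^+ 2) =
    2 * expR (z ^+ 2 - y ^+ 2) * (spi / 2 * expR (y ^+ 2)).
  have -> : expR (z ^+ 2) = expR (z ^+ 2 - y ^+ 2) * expR (y ^+ 2).
    by rewrite -expRD subrK.
  by field.
by rewrite ler_wpM2l ?mills_ge// mulr_ge0 ?expR_ge0.
Qed.

Let c := (um - up) / (2 * eps).
Let c_gt0 : 0 < c. Proof. by rewrite divr_gt0 ?subr_gt0 ?mulr_gt0. Qed.

Let gap : a ^+ 2 - b ^+ 2 = (x - (um + up) / 2 * tau) * c.
Proof.
rewrite subr_sqr zrightBleft// zrightDleft// -/k.
have -> : 2 * (x - (um + up) / 2 * tau) / k * ((um - up) * tau / k) =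
  2 * (x - (um + up) / 2 * tau) * ((um - up) * tau) / k ^+ 2.
  by field; rewrite gt_eqF.
by rewrite width_sqr// /c; field; rewrite !gt_eqF.
Qed.

Let expR_le_inv (y : R) : 0 < y -> expR (- y) <= y^-1.
Proof.
move=> y0; rewrite expRN lef_pV2 ?posrE ?expR_gt0//.
by apply: le_trans (expR_ge1Dx y); rewrite lerDr.
Qed.

Let decay_rateE (d : R) : 0 < d -> 2 * (d * c)^-1 = 4 * eps / (d * (um - up)).
Proof.
move=> d0; rewrite /c; have : 0 < um - up by rewrite subr_gt0.
by move: (um - up) => e e0; field; rewrite !gt_eqF.
Qed.

(** To the right of the shock [zright] exceeds [zleft] in modulus, and [pleft] is
    at most [mills zleft / mills zright <= 2 * exp (zleft^2 - zright^2)].  The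
    exponent is [- (x - X) * (um - up) / (2 * eps)]; [exp (- y) <= 1 / y] turns
    this into a rate. *)
Lemma pleft_decay : (um + up) / 2 * tau < x ->
  pleft eps x tau <= 4 * eps / ((x - (um + up) / 2 * tau) * (um - up)).
Proof.
move=> Xx; have d0 : 0 < x - (um + up) / 2 * tau by rewrite subr_gt0.
have ab : 0 <= a - b.
  by rewrite zrightBleft// divr_ge0 ?ltW// mulr_gt0.
have a0 : 0 <= a by have := ab_ge0; lra.
have /le_trans -> // : pleft eps x tau <= mills b / mills a.
  rewrite /pleft -/b ler_pM2l ?mills_gt0//.
  by rewrite lef_pV2 ?posrE ?total_gt0 ?mills_gt0// lerDl ltW// mills_gt0.
apply: (le_trans (mills_ratio _ a0)).
rewrite -opprB gap.
apply: (@le_trans _ _ (2 * ((x - (um + up) / 2 * tau) * c)^-1)).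
  by rewrite ler_wpM2l// expR_le_inv// mulr_gt0.
by rewrite decay_rateE.
Qed.

Lemma pright_decay : x < (um + up) / 2 * tau ->
  pright eps x tau <= 4 * eps / (((um + up) / 2 * tau - x) * (um - up)).
Proof.
move=> Xx; have d0 : 0 < (um + up) / 2 * tau - x by rewrite subr_gt0.
have ab : a - b <= 0.
  rewrite zrightBleft// -[_ - _ * tau]opprB mulrN mulNr oppr_le0.
  by rewrite divr_ge0 ?ltW// mulr_gt0.
have b0 : 0 <= b by have := ab_ge0; lra.
have /le_trans -> // : pright eps x tau <= mills a / mills b.
  rewrite /pright -/a ler_pM2l ?mills_gt0//.
  by rewrite lef_pV2 ?posrE ?total_gt0 ?mills_gt0// lerDr ltW// mills_gt0.
apply: (le_trans (mills_ratio _ b0)).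
rewrite gap.
have -> : (x - (um + up) / 2 * tau) * c = - (((um + up) / 2 * tau - x) * c) by ring.
apply: (@le_trans _ _ (2 * (((um + up) / 2 * tau - x) * c)^-1)).
  by rewrite ler_wpM2l// expR_le_inv// mulr_gt0.
by rewrite decay_rateE.
Qed.

Lemma WprofileE : Wprofile rhom rhop um up eps x tau =
  rhom * (x - um * tau) * pleft eps x tau + rhop * (x - up * tau) * pright eps x tau
  + (rhop - rhom) * (k / 2) / total eps x tau.
Proof.
rewrite /Wprofile -/k -/a -/b.
have -> : x - um * tau = - (k * b) by rewrite /b /zleft -/k; field; rewrite gt_eqF.
have -> : x - up * tau = k * a by rewrite /a /zright -/k; field; rewrite gt_eqF.
rewrite /pleft /pright -/a -/b.
have := total_gt0 um up eps x tau; rewrite /total -/a -/b.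
set P := mills a; set Q := mills b => S0.
by field; rewrite !gt_eqF.
Qed.

Let rest_bound : `|(rhop - rhom) * (k / 2) / total eps x tau| <=
  `|rhop - rhom| * k / spi.
Proof.
rewrite -!mulrA normrM ler_wpM2l//.
have k20 : 0 <= k / 2 by rewrite divr_ge0 ?ltW.
rewrite ger0_norm; last first.
  by rewrite mulrA mulr_ge0 ?invr_ge0 ?(ltW (total_gt0 _ _ _ _ _)).
have -> : k / spi = k / 2 * (2 / spi) by field; rewrite gt_eqF.
by rewrite mulrA ler_wpM2l// inv_total_le.
Qed.

Lemma Wprofile_bound : `|Wprofile rhom rhop um up eps x tau| <=
  rhom * `|x - um * tau| + rhop * `|x - up * tau| + `|rhop - rhom| * k / spi.
Proof.
rewrite WprofileE; apply: (le_trans (ler_normD _ _)).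
apply: lerD; last exact: rest_bound.
apply: (le_trans (ler_normD _ _)); apply: lerD.
- rewrite normrM [`|rhom * _|]normrM (gtr0_norm rhom_gt0) (ger0_norm (pleft_ge0 _ _ _ _ _)).
  by rewrite ler_piMr ?pleft_le1// mulr_ge0// ltW.
- rewrite normrM [`|rhop * _|]normrM (gtr0_norm rhop_gt0) (ger0_norm (pright_ge0 _ _ _ _ _)).
  by rewrite ler_piMr ?pright_le1// mulr_ge0// ltW.
Qed.

(** What separates [Wprofile] from its limit on the right of the shock is the
    weight of the left state and a term of order [width]. *)
Lemma Wprofile_right : `|Wprofile rhom rhop um up eps x tau - rhop * (x - up * tau)|
  <= `|rhom * (x - um * tau) - rhop * (x - up * tau)| * pleft eps x tau +
     `|rhop - rhom| * k / spi.
Proof.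
have pE : pright eps x tau = 1 - pleft eps x tau.
  by rewrite -(pleftD um up eps x tau) addrAC subrr add0r.
rewrite WprofileE pE.
set T := _ / total _ _ _.
have -> : rhom * (x - um * tau) * pleft eps x tau +
  rhop * (x - up * tau) * (1 - pleft eps x tau) + T - rhop * (x - up * tau) =
  (rhom * (x - um * tau) - rhop * (x - up * tau)) * pleft eps x tau + T by ring.
apply: (le_trans (ler_normD _ _)); apply: lerD; last exact: rest_bound.
by rewrite normrM (ger0_norm (pleft_ge0 _ _ _ _ _)).
Qed.

Lemma Wprofile_left : `|Wprofile rhom rhop um up eps x tau - rhom * (x - um * tau)|
  <= `|rhop * (x - up * tau) - rhom * (x - um * tau)| * pright eps x tau +
     `|rhop - rhom| * k / spi.
Proof.
have pE : pleft eps x tau = 1 - pright eps x tau.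
  by rewrite -(pleftD um up eps x tau) addrK.
rewrite WprofileE pE.
set T := _ / total _ _ _.
have -> : rhom * (x - um * tau) * (1 - pright eps x tau) +
  rhop * (x - up * tau) * pright eps x tau + T - rhom * (x - um * tau) =
  (rhop * (x - up * tau) - rhom * (x - um * tau)) * pright eps x tau + T by ring.
apply: (le_trans (ler_normD _ _)); apply: lerD; last exact: rest_bound.
by rewrite normrM (ger0_norm (pright_ge0 _ _ _ _ _)).
Qed.

(** As [tau] tends to [0], only [zleft] and [zright], of order [1 / width], are
    unbounded, and they come with the factor [zright + zleft], of order
    [width]. *)
Lemma rho_profile_bound : `|rho_profile rhom rhop um up eps x tau| <=
  rhom + rhop + (um - up) * k / (4 * eps) * (rhom + rhop) * (2 / spi) +
  (um - up) / (2 * eps) * (rhom * `|x - um * tau| + rhop * `|x - up * tau|).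
Proof.
have dE : a + b = (um - up) * k / (4 * eps).
  rewrite zrightDleft// -/k.
  have -> : tau = k ^+ 2 / (4 * eps) by rewrite width_sqr//; field; rewrite gt_eqF.
  by field; rewrite !gt_eqF.
have d0 : 0 <= (um - up) * k / (4 * eps) by rewrite -dE.
have pl0 := pleft_ge0 um up eps x tau; have pr0 := pright_ge0 um up eps x tau.
have pl1 := pleft_le1; have pr1 := pright_le1.
have mixed : `|rhom * pleft eps x tau + rhop * pright eps x tau| <= rhom + rhop.
  rewrite ger0_norm; last by apply: addr_ge0; apply: mulr_ge0 => //; exact: ltW.
  by apply: lerD; rewrite ler_piMr//; exact: ltW.
have mixed' : `|rhom * pright eps x tau + rhop * pleft eps x tau| <= rhom + rhop.
  rewrite ger0_norm; last by apply: addr_ge0; apply: mulr_ge0 => //; exact: ltW.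
  by apply: lerD; rewrite ler_piMr//; exact: ltW.
rewrite /rho_profile -/a -/b dE.
apply: (le_trans (ler_normD _ _)); apply: lerD.
  apply: (le_trans (ler_normD _ _)); apply: lerD => //.
  have iS0 : 0 <= (total eps x tau)^-1 by rewrite invr_ge0 ltW ?total_gt0.
  rewrite normrM [`|_ * (_ + _)|]normrM (ger0_norm d0) (ger0_norm iS0).
  apply: ler_pM => //; last exact: inv_total_le.
    by apply: mulr_ge0.
  by rewrite ler_wpM2l.
have -> : 2 * ((um - up) * k / (4 * eps)) * (pleft eps x tau * pright eps x tau) *
  (rhom * b + rhop * a) = (um - up) / (2 * eps) *
   (pleft eps x tau * pright eps x tau * (rhom * (k * b) + rhop * (k * a))).
  by field; rewrite gt_eqF.
have -> : k * b = - (x - um * tau) by rewrite /b /zleft -/k; field; rewrite gt_eqF.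
have -> : k * a = x - up * tau by rewrite /a /zright -/k; field; rewrite gt_eqF.
rewrite normrM (ger0_norm (ltW c_gt0)) (ler_pM2l c_gt0).
have pp : `|pleft eps x tau * pright eps x tau| <= 1.
  by rewrite (ger0_norm (mulr_ge0 pl0 pr0)) mulr_ile1.
rewrite normrM; apply: (le_trans (ler_piMl (normr_ge0 _) pp)).
by apply: (le_trans (ler_normD _ _)); apply: lerD;
  rewrite normrM ?normrN gtr0_norm.
Qed.

End estimates.

End profile_estimates.

(** * Dominated convergence off a curve *)

Section plane_limits.
Context {R : realType}.
Local Notation leb := (@lebesgue_measure R).
Local Notation plane := (measurableTypeR R * measurableTypeR R)%type.

Lemma measurable_graph (X : R -> R) : continuous X ->
  measurable [set p : R * R | p.1 = X p.2].
Proof.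
move=> cX; have mf : measurable_fun setT (fun p : R * R => p.1 - X p.2).
  apply: continuous_measurable2 => p; apply: continuousB; first exact: cvg_fst.
  by apply: continuous_comp; [exact: cvg_snd|exact: cX].
have := mf measurableT [set 0] (measurable_set1 0).
rewrite setTI; congr (measurable _); apply/seteqP; split=> p /=.
  by move=> /eqP; rewrite subr_eq0 => /eqP.
by move=> ->; rewrite subrr.
Qed.

(** The shear maps the vertical axis onto the graph. *)
Lemma graph_null (X : R -> R) : continuous X ->
  leb2 [set p : R * R | p.1 = X p.2] = 0%E.
Proof.
move=> cX; rewrite (leb2_shear (continuous_measurable_fun cX)); last first.
  exact: measurable_graph.
rewrite /pushforward (_ : _ @^-1` _ = [set 0] `*` setT).
  have -> : leb2 ([set 0] `*` setT) = (leb [set 0%R] * leb setT)%E.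
    by apply: product_measure1E.
  by rewrite lebesgue_measure_set1 mul0e.
apply/seteqP; split=> [[y t]|[y t]]; rewrite /shear /=.
  by move=> h; split => //=; lra.
by move=> [/= -> _]; rewrite add0r.
Qed.

Lemma integrable_upper_norm (f : R * R -> R) (M C : R) :
  continuous f -> vanish M f ->
  leb2.-integrable upper (EFin \o (fun p => C * `|f p|)).
Proof.
move=> cf vf; apply: upper_integrable_scale.
have cnf : continuous (fun p => `|f p|).
  by move=> p; apply: cvg_norm; exact: cf.
have vnf : vanish M (fun p => `|f p|) by move=> p Mp; rewrite vf// normr0.
have h := @integrable_upper R (cst 1) (cst 1) _ 1 M (locint_cst 1)
  (@measurable_cst _ _ _ _ _ _).
have {}h := h _ _ cnf vnf.
apply: upper_eq_integrable (h _) => [p _ /=|p _]; first by rewrite !mul1r.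
by rewrite normr1.
Qed.

Lemma integrable_upper_supp (g f : R * R -> R) (M C : R) :
  measurable_fun upper g ->
  (forall p, upper p -> `|p.1| < M -> `|p.2| < M -> `|g p| <= C) ->
  continuous f -> vanish M f ->
  leb2.-integrable upper (EFin \o (g \* f)) /\
  forall p, upper p -> `|g p * f p| <= C * `|f p|.
Proof.
move=> mg gC cf vf.
have dom p : upper p -> `|g p * f p| <= C * `|f p|.
  move=> up0; rewrite normrM.
  have [Mp|] := pselect (M <= `|p.1| \/ M <= `|p.2|).
    by rewrite vf// normr0 !mulr0.
  move=> /not_orP[/negP + /negP]; rewrite -!ltNge => p1 p2.
  by rewrite ler_wpM2r// gC.
split => //; apply: (@upper_integrable_le _ _ (fun p => C * `|f p|)) => //.
  by apply: measurable_funM => //; apply: measurable_funTS; exact: continuous_measurable2.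
exact: integrable_upper_norm cf vf.
Qed.

(** The graph of [X] is a null set, and only small values of [eps] matter for the
    limit, so a bound for [eps <= 1] suffices. *)
Lemma cvg_int_upper (X : R -> R) (g_ : R -> R * R -> R) (g f : R * R -> R)
    (M C : R) : continuous X ->
  (forall eps, 0 < eps -> measurable_fun upper (g_ eps)) ->
  measurable_fun upper g ->
  (forall eps, 0 < eps -> eps <= 1 -> forall p, upper p ->
     `|p.1| < M -> `|p.2| < M -> `|g_ eps p| <= C) ->
  (forall p, upper p -> p.1 != X p.2 -> g_ eps p @[eps --> 0^'+] --> g p) ->
  continuous f -> vanish M f ->
  int_upper (g_ eps \* f) @[eps --> 0^'+] --> int_upper (g \* f).
Proof.
move=> cX mg_ mg gC g_g cf vf.
(* The truncation makes the bound available along every sequence. *)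
pose h_ eps := g_ (Num.min eps 1) \* f.
have near_min : \forall eps \near (0 : R)^'+, Num.min eps 1 = eps.
  near=> eps; apply/min_idPl; near: eps; exact: nbhs_right_le.
apply: (@cvg_trans _ (int_upper (h_ eps) @[eps --> 0^'+])).
  apply: near_eq_cvg; apply: filterS near_min => eps E.
  by rewrite /h_ E.
apply/cvg_at_rightP => u [u0 ucvg].
pose v n := Num.min (u n) 1.
have v0 n : 0 < v n by rewrite /v lt_min u0 ltr01.
have v1 n : v n <= 1 by rewrite /v ge_min lexx orbT.
have iv n := integrable_upper_supp (mg_ _ (v0 n)) (gC _ (v0 n) (v1 n)) cf vf.
have mf : measurable_fun upper f.
  by apply: measurable_funTS; exact: continuous_measurable2.
have vcvg : v n @[n --> \oo] --> 0.
  apply: (@squeeze_cvgr _ _ _ _ (cst 0) u) => //; last exact: cvg_cst.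
  by apply: nearW => n; rewrite (ltW (v0 n))/= /v ge_min lexx.
have idom := integrable_upper_norm C cf vf.
have [] := @dominated_convergence _ plane R leb2 upper measurable_upper
  (fun n => EFin \o h_ (u n)) (EFin \o (g \* f)) (EFin \o (fun p => C * `|f p|)).
- by move=> n; exact: measurable_int (iv n).1.
- by apply/measurable_EFinP; exact: measurable_funM.
- exists [set p : R * R | p.1 = X p.2]; split.
  + exact: measurable_graph.
  + exact: graph_null.
  move=> p /= h; apply: contrapT => /eqP pX; apply: h => p0.
  apply: cvg_EFin; first exact: nearW.
  apply: cvgM; last exact: cvg_cst.
  by have /cvg_at_rightP := g_g p p0 pX => /(_ v); apply; split.
- exact: idom.
- by apply: aeW => p n p0 /=; rewrite lee_fin; exact: (iv n).2.
move=> ig _ cvg_.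
have E : (\int[leb2]_(p in upper) (g p * f p)%:E)%E = (int_upper (g \* f))%:E.
  by rewrite /int_upper /Rintegral fineK//; exact: (@integrable_fin_num _ plane R leb2 upper measurable_upper _ ig).
have cvgE : (\int[leb2]_(p in upper) (h_ (u n) p)%:E)%E @[n --> \oo] -->
    (int_upper (g \* f))%:E by rewrite -E; exact: cvg_.
exact: (fine_cvg cvgE).
Unshelve. all: by end_near. Qed.

End plane_limits.

(** * Pointwise limits and uniform bounds *)

Section local_bounds.
Context {R : realType}.
Local Notation leb := (@lebesgue_measure R).
Local Notation plane := (measurableTypeR R * measurableTypeR R)%type.

Lemma locally_integrable_bounded (f : R * R -> R) : measurable_fun upper f ->
  (forall N : R, exists C : R, forall p, upper p -> `|p.1| <= N -> `|p.2| <= N ->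
    `|f p| <= C) -> locally_integrable2 f.
Proof.
move=> mf fC K cK KU.
have [N KN] : exists N : R, forall p, K p -> `|p.1| <= N /\ `|p.2| <= N.
  have [C [_ CP]] := compact_bounded cK; exists (`|C| + 1) => p Kp.
  have : `|p| <= `|C| + 1 by apply: CP => //; rewrite ltr_pwDr// ler_norm.
  by rewrite prod_normE ge_max => /andP[].
have [C CP] := fC N.
have mK := compact_measurable2 cK.
pose I : set R := `[- N, N]%classic; pose box := I `*` I.
have mbox : measurable box by apply: measurableX; exact: measurable_itv.
apply: (@measurable_bounded_integrable _ plane R leb2 f K mK).
- apply: (@le_lt_trans _ _ (leb2 box)).
    apply: le_measure; rewrite ?inE//.
    move=> p /KN[]; rewrite !ler_norml => /andP[? ?] /andP[? ?].
    by split; rewrite /I /= in_itv/=; apply/andP.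
  have -> : leb2 box = (leb I * leb I)%E.
    by apply: product_measure1E; exact: measurable_itv.
  rewrite /I lebesgue_measure_itv/=; case: ifP => _; last by rewrite mule0.
  by rewrite -EFinB -EFinM ltry.
- by apply: measurable_funS mf => //; exact: measurable_upper.
- exists C; split; first exact: num_real.
  move=> D CD p Kp /=; rewrite (le_trans _ (ltW CD))//.
  by have [? ?] := KN p Kp; apply: CP => //; exact: KU.
Qed.

Lemma measurable_inv : measurable_fun setT (@GRing.inv R).
Proof.
rewrite (_ : setT = [set x | x != 0] `|` [set 0]); last first.
  apply/seteqP; split=> x //= _; have [->|] := eqVneq x 0; [by right|by left].
have o0 : open [set x : R | x != 0].
  rewrite (_ : [set x | x != 0] = ~` [set 0]); last first.
    by apply/seteqP; split=> x /= /eqP.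
  by apply: closed_openC; exact: closed_eq.
apply/measurable_funU => //; first exact: open_measurable.
split; last exact: measurable_fun_set1.
apply: open_continuous_measurable_fun => // x; rewrite inE/= => x0.
exact: inv_continuous.
Qed.

Lemma cvg_at_right_rate (F : R -> R) (l a b : R) :
  (forall eps, 0 < eps -> `|F eps - l| <= a * eps + b * Num.sqrt eps) ->
  F eps @[eps --> 0^'+] --> l.
Proof.
move=> Fl.
have rate0 : (a * eps + b * Num.sqrt eps) @[eps --> 0^'+] --> 0.
  rewrite [X in _ --> X](_ : 0 = a * 0 + b * Num.sqrt 0); last first.
    by rewrite sqrtr0 !mulr0 addr0.
  apply: cvg_at_right_filter; apply: cvgD; apply: cvgM.
  - exact: cvg_cst.
  - exact: cvg_id.
  - exact: cvg_cst.
  - exact: sqrt_continuous.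
apply/cvgrPdist_le => e e0; near=> eps.
rewrite distrC; apply: (@le_trans _ _ (a * eps + b * Num.sqrt eps)).
  by apply: Fl; near: eps; exact: nbhs_right_gt.
apply: (le_trans (ler_norm _)).
by near: eps; move/cvgr0Pnorm_le : rate0; exact.
Unshelve. all: by end_near. Qed.

End local_bounds.

Section viscous_limit.
Context {R : realType}.
Local Notation leb := (@lebesgue_measure R).
Variables (alpha sigma : R -> R) (rhom rhop um up : R).
Hypothesis alpha_ge0 : {ae leb, forall t, 0 <= t -> 0 <= alpha t}.
Hypothesis alpha_L1 : leb.-integrable `[0, +oo[ (EFin \o alpha).
Hypothesis sigma_ge0 : {ae leb, forall t, 0 <= t -> 0 <= sigma t}.
Hypothesis sigma_L1loc : L1_loc sigma.
Hypothesis rhom_gt0 : 0 < rhom.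
Hypothesis rhop_gt0 : 0 < rhop.
Hypothesis u_gt : up < um.

Local Notation B := (Bint alpha sigma).
Local Notation X := (shock_position alpha sigma um up).
Local Notation w := (shock_weight alpha sigma rhom rhop um up).
Local Notation spi := (Num.sqrt (pi : R)).

Let B_ge0 t : 0 <= B t. Proof. exact: Bint_ge0. Qed.
Let B_cont : continuous B. Proof. exact: Bint_continuous. Qed.
Let B_homo : {homo B : s t / s <= t}. Proof. exact: Bint_homo. Qed.
Let cX : continuous X. Proof. exact: shock_position_continuous. Qed.

(** While [Bint] vanishes, [rho_visc] is the initial density, whose primitive in
    [x] takes the place of [Wprofile]. *)
Definition potential eps (p : R * R) : R :=
  if B p.2 == 0 then riemann rhom rhop p.1 * p.1
  else Wprofile rhom rhop um up eps p.1 (B p.2).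

Definition potential_limit (p : R * R) : R :=
  if p.1 < X p.2 then rhom * (p.1 - um * B p.2) else rhop * (p.1 - up * B p.2).

Let B_gt0 t : B t != 0 -> 0 < B t.
Proof. by move=> h; rewrite lt_neqAle eq_sym h B_ge0. Qed.

Lemma rho_visc_cases eps p : 0 < eps ->
  rho_visc alpha sigma rhom rhop um up eps p =
  if B p.2 == 0 then riemann rhom rhop p.1
  else rho_profile rhom rhop um up eps p.1 (B p.2).
Proof.
move=> eps0; case: p => x t; case: ifPn => [Bt|/B_gt0 Bt].
  by rewrite /rho_visc /= ?Bt.
exact: rho_viscE.
Qed.

Lemma u_visc_cases eps p : 0 < eps ->
  u_visc alpha sigma um up eps p =
  (if B p.2 == 0 then riemann um up p.1
   else up * pright um up eps p.1 (B p.2) + um * pleft um up eps p.1 (B p.2))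
  * damping sigma p.2.
Proof.
move=> eps0; case: p => x t; case: ifPn => [Bt|/B_gt0 Bt].
  by rewrite /u_visc ?Bt.
exact: u_viscE.
Qed.

Let mfst : measurable_fun setT (fst : R * R -> R). Proof. exact: measurable_fst. Qed.

Let mB : measurable_fun setT (fun p : R * R => B p.2).
Proof.
by apply: measurableT_comp measurable_snd; exact: continuous_measurable_fun B_cont.
Qed.

Let mBeq : measurable_fun setT (fun p : R * R => B p.2 == 0).
Proof. exact: measurable_fun_eqr. Qed.

Let mriemann l r : measurable_fun setT (fun p : R * R => riemann l r p.1).
Proof. by apply: measurable_fun_ifT => //; exact: measurable_fun_ltr. Qed.

Section measurability.
Variable eps : R.

Let mwidth : measurable_fun setT (fun p : R * R => width eps (B p.2)).
Proof.
apply: (measurableT_comp (continuous_measurable_fun (@sqrt_continuous R))).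
exact: measurable_funM.
Qed.

Let minv (f : R * R -> R) : measurable_fun setT f ->
  measurable_fun setT (fun p => (f p)^-1).
Proof. by move=> mf; exact: (measurableT_comp measurable_inv). Qed.

Let mr : measurable_fun setT (fun p : R * R => zright up eps p.1 (B p.2)).
Proof.
apply: measurable_funM; last exact: minv.
by apply: measurable_funB => //; exact: measurable_funM.
Qed.

Let ml : measurable_fun setT (fun p : R * R => zleft um eps p.1 (B p.2)).
Proof.
apply: measurable_funM; last exact: minv.
apply: measurableT_comp => //.
by apply: measurable_funB => //; exact: measurable_funM.
Qed.

Let mmills (f : R * R -> R) : measurable_fun setT f ->
  measurable_fun setT (fun p => mills (f p)).
Proof.
by apply: measurableT_comp; exact: continuous_measurable_fun (@mills_continuous R).
Qed.

Let mtotal : measurable_fun setT (fun p : R * R => total um up eps p.1 (B p.2)).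
Proof. by apply: measurable_funD; exact: mmills. Qed.

Let mpr : measurable_fun setT (fun p : R * R => pright um up eps p.1 (B p.2)).
Proof. by apply: measurable_funM; [exact: mmills|exact: minv]. Qed.

Let mpl : measurable_fun setT (fun p : R * R => pleft um up eps p.1 (B p.2)).
Proof. by apply: measurable_funM; [exact: mmills|exact: minv]. Qed.

Lemma measurable_potential : measurable_fun setT (potential eps).
Proof.
apply: measurable_fun_ifT => //; first exact: measurable_funM.
apply: measurable_funM; last exact: minv.
apply: measurable_funM => //.
apply: measurable_funB; apply: measurable_funM => //; apply: measurable_funD => //;
  by apply: measurable_funM => //; exact: mmills.
Qed.

Lemma measurable_rho_visc : 0 < eps ->
  measurable_fun setT (rho_visc alpha sigma rhom rhop um up eps).
Proof.
move=> eps0; rewrite (funext (fun p => rho_visc_cases p eps0)).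
apply: measurable_fun_ifT => //.
apply: measurable_funD.
  apply: measurable_funD; first by apply: measurable_funD; exact: measurable_funM.
  apply: measurable_funM; last exact: minv.
  apply: measurable_funM; first exact: measurable_funD.
  by apply: measurable_funD; exact: measurable_funM.
apply: measurable_funM; last by apply: measurable_funD; exact: measurable_funM.
apply: measurable_funM; last exact: measurable_funM.
by apply: measurable_funM => //; exact: measurable_funD.
Qed.

Lemma measurable_u_visc : 0 < eps ->
  measurable_fun setT (u_visc alpha sigma um up eps).
Proof.
move=> eps0; rewrite (funext (fun p => u_visc_cases p eps0)).
apply: measurable_funM.
  apply: measurable_fun_ifT => //.
  by apply: measurable_funD; exact: measurable_funM.
apply: measurableT_comp measurable_snd.
exact: continuous_measurable_fun (damping_continuous sigma_L1loc).
Qed.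

End measurability.

Let riemann_bound (l r x : R) : `|riemann l r x| <= `|l| + `|r|.
Proof. by rewrite /riemann; case: ifP => _; rewrite ?lerDl ?lerDr. Qed.

Lemma u_visc_bound eps p : 0 < eps ->
  `|u_visc alpha sigma um up eps p| <= `|um| + `|up|.
Proof.
move=> eps0; rewrite u_visc_cases// normrM -[leRHS]mulr1; apply: ler_pM => //.
  case: ifP => _; first exact: riemann_bound.
  rewrite addrC; apply: (le_trans (ler_normD _ _)); apply: lerD; rewrite normrM.
    by rewrite ler_piMr// (ger0_norm (pleft_ge0 _ _ _ _ _)) pleft_le1.
  by rewrite ler_piMr// (ger0_norm (pright_ge0 _ _ _ _ _)) pright_le1.
by rewrite ger0_norm ?damping_le1// ltW// damping_gt0.
Qed.

Let shift_bound (v x t N : R) : `|x| <= N -> `|t| <= N ->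
  `|x - v * B t| <= N + `|v| * B N.
Proof.
move=> xN tN; apply: (le_trans (ler_normB _ _)); apply: lerD => //.
rewrite normrM ler_wpM2l// ger0_norm//.
by apply: B_homo; rewrite (le_trans (ler_norm _)).
Qed.

Let width_bound (eps t N : R) : 0 < eps -> `|t| <= N ->
  width eps (B t) <= width eps (B N).
Proof.
move=> eps0 tN; rewrite /width ler_wsqrtr// ler_wpM2l//.
  by rewrite mulr_ge0 ?ltW.
by apply: B_homo; rewrite (le_trans (ler_norm _)).
Qed.

Lemma rho_visc_bound eps N : 0 < eps -> exists C, forall p, upper p ->
  `|p.1| <= N -> `|p.2| <= N -> `|rho_visc alpha sigma rhom rhop um up eps p| <= C.
Proof.
move=> eps0.
have spi0 : 0 < spi by rewrite sqrtr_gt0 pi_gt0.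
pose E := rhom + rhop +
  (um - up) * width eps (B N) / (4 * eps) * (rhom + rhop) * (2 / spi) +
  (um - up) / (2 * eps) *
    (rhom * (N + `|um| * B N) + rhop * (N + `|up| * B N)).
exists (`|rhom| + `|rhop| + `|E|) => p p0 p1 p2; rewrite rho_visc_cases//.
have d0 : 0 < um - up by rewrite subr_gt0.
case: ifPn => [_|/B_gt0 Bt].
  by apply: (le_trans (riemann_bound _ _ _)); rewrite lerDl.
apply: (le_trans (rho_profile_bound rhom_gt0 rhop_gt0 u_gt p.1 eps0 Bt)).
apply: (@le_trans _ _ E); last first.
  by apply: (le_trans (ler_norm _)); rewrite lerDr addr_ge0.
apply: lerD; last first.
  have c0 : 0 <= (um - up) / (2 * eps) by rewrite divr_ge0 ?(ltW d0) ?mulr_ge0 ?(ltW eps0).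
  apply: (ler_wpM2l c0); apply: lerD.
    by apply: (ler_wpM2l (ltW rhom_gt0)); exact: shift_bound.
  by apply: (ler_wpM2l (ltW rhop_gt0)); exact: shift_bound.
apply: lerD => //.
have s0 : 0 <= 2 / spi by rewrite divr_ge0 ?(ltW spi0).
apply: (ler_wpM2r s0).
have r0 : 0 <= rhom + rhop by rewrite addr_ge0 ?(ltW rhom_gt0) ?(ltW rhop_gt0).
apply: (ler_wpM2r r0).
have e0 : 0 <= (4 * eps)^-1 by rewrite invr_ge0 mulr_ge0 ?(ltW eps0).
apply: (ler_wpM2r e0); apply: (ler_wpM2l (ltW d0)).
exact: width_bound.
Qed.

Lemma potential_bound e N : exists C, forall eps, 0 < eps -> eps <= e ->
  forall p, upper p -> `|p.1| < N -> `|p.2| < N -> `|potential eps p| <= C.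
Proof.
have spi0 : 0 < spi by rewrite sqrtr_gt0 pi_gt0.
pose E := rhom * (N + `|um| * B N) + rhop * (N + `|up| * B N) +
  `|rhop - rhom| * width e (B N) / spi.
exists ((`|rhom| + `|rhop|) * N + `|E|).
move=> eps eps0 eps1 p p0 /ltW p1 /ltW p2; rewrite /potential.
have N0 : 0 <= N by rewrite (le_trans _ p1).
case: ifPn => [_|/B_gt0 Bt].
  rewrite normrM ler_wpDr//; apply: ler_pM => //; exact: riemann_bound.
apply: (le_trans (Wprofile_bound rhom_gt0 rhop_gt0 u_gt p.1 eps0 Bt)).
apply: (@le_trans _ _ E); last first.
  by apply: (le_trans (ler_norm _)); rewrite lerDr mulr_ge0// addr_ge0.
apply: lerD.
  apply: lerD.
    by apply: (ler_wpM2l (ltW rhom_gt0)); exact: shift_bound.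
  by apply: (ler_wpM2l (ltW rhop_gt0)); exact: shift_bound.
have s0 : 0 <= spi^-1 by rewrite invr_ge0 (ltW spi0).
apply: (ler_wpM2r s0); apply: (ler_wpM2l (normr_ge0 _)).
apply: (le_trans (width_bound eps0 p2)).
by rewrite /width ler_wsqrtr// ler_wpM2r// ler_wpM2l.
Qed.

Lemma locally_integrable_rho_visc eps : 0 < eps ->
  locally_integrable2 (rho_visc alpha sigma rhom rhop um up eps).
Proof.
move=> eps0; apply: locally_integrable_bounded => [|N].
  exact: measurable_funTS (measurable_rho_visc eps0).
exact: rho_visc_bound.
Qed.

Lemma locally_integrable_u_visc eps : 0 < eps ->
  locally_integrable2 (u_visc alpha sigma um up eps).
Proof.
move=> eps0; apply: locally_integrable_bounded => [|N].
  exact: measurable_funTS (measurable_u_visc eps0).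
by exists (`|um| + `|up|) => p *; exact: u_visc_bound.
Qed.

Let width_rate (eps tau : R) : 0 <= tau ->
  width eps tau = Num.sqrt (4 * tau) * Num.sqrt eps.
Proof.
by move=> t0; rewrite /width -sqrtrM ?mulr_ge0//; congr Num.sqrt; ring.
Qed.

Lemma cvg_potential p : p.1 != X p.2 ->
  potential eps p @[eps --> 0^'+] --> potential_limit p.
Proof.
move=> pX; rewrite /potential /potential_limit.
have spi0 : 0 < spi by rewrite sqrtr_gt0 pi_gt0.
have d0 : 0 < um - up by rewrite subr_gt0.
have [B0|/B_gt0 Bt] := eqVneq (B p.2) 0.
  rewrite /shock_position B0 !mulr0 !subr0 /riemann.
  by case: ifP => _; exact: cvg_cst.
have restE eps : `|rhop - rhom| * width eps (B p.2) / spi =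
    `|rhop - rhom| * Num.sqrt (4 * B p.2) / spi * Num.sqrt eps.
  by rewrite width_rate ?(ltW Bt)//; ring.
case: ltgtP pX => // [pX|pX] _.
  pose A := `|rhop * (p.1 - up * B p.2) - rhom * (p.1 - um * B p.2)|.
  apply: (@cvg_at_right_rate _ _ _ (A * (4 / ((X p.2 - p.1) * (um - up))))
    (`|rhop - rhom| * Num.sqrt (4 * B p.2) / spi)) => eps e0.
  apply: (le_trans (Wprofile_left _ _ u_gt p.1 e0 Bt)); rewrite restE -/A.
  apply: lerD => //; rewrite -[leRHS]mulrA; apply: ler_wpM2l; first exact: normr_ge0.
  by apply: (le_trans (pright_decay u_gt e0 Bt pX)); rewrite mulrAC.
pose A := `|rhom * (p.1 - um * B p.2) - rhop * (p.1 - up * B p.2)|.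
apply: (@cvg_at_right_rate _ _ _ (A * (4 / ((p.1 - X p.2) * (um - up))))
  (`|rhop - rhom| * Num.sqrt (4 * B p.2) / spi)) => eps e0.
apply: (le_trans (Wprofile_right _ _ u_gt p.1 e0 Bt)); rewrite restE -/A.
apply: lerD => //; rewrite -[leRHS]mulrA; apply: ler_wpM2l; first exact: normr_ge0.
by apply: (le_trans (pleft_decay u_gt e0 Bt pX)); rewrite mulrAC.
Qed.

Lemma cvg_u_visc p : p.1 != X p.2 ->
  u_visc alpha sigma um up eps p @[eps --> 0^'+] -->
  three_states alpha sigma um up um ((um + up) / 2) up p * damping sigma p.2.
Proof.
move=> pX.
have near_pos : \forall eps \near (0 : R)^'+, 0 < eps by exact: nbhs_right_gt.
have d0 : 0 < um - up by rewrite subr_gt0.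
apply: (@cvg_trans _ ((fun eps => (if B p.2 == 0 then riemann um up p.1
   else up * pright um up eps p.1 (B p.2) + um * pleft um up eps p.1 (B p.2))
  * damping sigma p.2) eps @[eps --> 0^'+])).
  by apply: near_eq_cvg; apply: filterS near_pos => eps e0; rewrite u_visc_cases.
apply: cvgM; last exact: cvg_cst.
have [B0|/B_gt0 Bt] := eqVneq (B p.2) 0.
  have X0 : X p.2 = 0 by rewrite /shock_position B0 mulr0.
  rewrite /three_states X0; rewrite X0 in pX.
  by rewrite /riemann (negbTE pX); exact: cvg_cst.
rewrite /three_states (negbTE pX).
case: ltgtP pX => // [pX|pX] _.
  apply: (@cvg_at_right_rate _ _ _
    ((um - up) * (4 / ((X p.2 - p.1) * (um - up)))) 0) => eps e0.
  have pE : pleft um up eps p.1 (B p.2) = 1 - pright um up eps p.1 (B p.2).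
    by rewrite -(pleftD um up eps p.1 (B p.2)) addrK.
  rewrite pE (_ : _ - um = - ((um - up) * pright um up eps p.1 (B p.2))); last by ring.
  rewrite normrN normrM gtr0_norm// ger0_norm ?pright_ge0// mul0r addr0 -mulrA.
  apply: (ler_wpM2l (ltW d0)).
  apply: (le_trans (pright_decay u_gt e0 Bt pX)).
  by rewrite mulrAC.
apply: (@cvg_at_right_rate _ _ _
    ((um - up) * (4 / ((p.1 - X p.2) * (um - up)))) 0) => eps e0.
have pE : pright um up eps p.1 (B p.2) = 1 - pleft um up eps p.1 (B p.2).
  by rewrite -(pleftD um up eps p.1 (B p.2)) addrAC subrr add0r.
rewrite pE (_ : _ - up = (um - up) * pleft um up eps p.1 (B p.2)); last by ring.
rewrite normrM gtr0_norm// ger0_norm ?pleft_ge0// mul0r addr0 -mulrA.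
apply: (ler_wpM2l (ltW d0)).
apply: (le_trans (pleft_decay u_gt e0 Bt pX)).
by rewrite mulrAC.
Qed.

End viscous_limit.

(** * The distributional limits *)

Section profile_continuity.
Context {R : realType}.
Variables (rhom rhop um up eps tau : R).

Let cz (v : R) : continuous (fun x : R => (x - v * tau) / width eps tau).
Proof.
by move=> x; apply: cvgM; [apply: cvgB; [exact: cvg_id|exact: cvg_cst]|exact: cvg_cst].
Qed.

Let cr : continuous (fun x : R => zright up eps x tau). Proof. exact: cz. Qed.

Let cl : continuous (fun x : R => zleft um eps x tau).
Proof.
move=> x; rewrite /zleft; apply: cvgM; last exact: cvg_cst.
by apply: cvgN; apply: cvgB; [exact: cvg_id|exact: cvg_cst].
Qed.

Let cm (z : R -> R) : continuous z -> continuous (fun x => mills (z x)).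
Proof. by move=> h x; apply: continuous_comp; [exact: h|exact: mills_continuous]. Qed.

Let ci : continuous (fun x : R => (total um up eps x tau)^-1).
Proof.
move=> x; apply: cvgV; first by rewrite gt_eqF// total_gt0.
by apply: cvgD; [exact: (@cm _ cr x)|exact: (@cm _ cl x)].
Qed.

Lemma rho_profile_continuous :
  continuous (fun x : R => rho_profile rhom rhop um up eps x tau).
Proof.
have cpr : continuous (fun x : R => pright um up eps x tau).
  by move=> x; apply: cvgM; [exact: (@cm _ cr x)|exact: ci].
have cpl : continuous (fun x : R => pleft um up eps x tau).
  by move=> x; apply: cvgM; [exact: (@cm _ cl x)|exact: ci].
have cZ (c : R) (f : R -> R) x : continuous f -> c * f y @[y --> x] --> c * f x.
  by move=> cf; apply: cvgM; [exact: cvg_cst|exact: cf].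
move=> x; rewrite /rho_profile.
apply: cvgD.
  apply: cvgD; first by apply: cvgD; exact: cZ.
  apply: cvgM; last exact: ci.
  by apply: cvgM; [apply: cvgD; [exact: cr|exact: cl]|apply: cvgD; exact: cZ].
apply: cvgM; last by apply: cvgD; exact: cZ.
apply: cvgM; last by apply: cvgM; [exact: cpl|exact: cpr].
apply: cvgM; first exact: cvg_cst.
by apply: cvgD; [exact: cr|exact: cl].
Qed.

End profile_continuity.

Section limit_of_densities.
Context {R : realType}.
Local Notation leb := (@lebesgue_measure R).
Variables (alpha sigma : R -> R) (rhom rhop um up : R).
Hypothesis alpha_ge0 : {ae leb, forall t, 0 <= t -> 0 <= alpha t}.
Hypothesis alpha_L1 : leb.-integrable `[0, +oo[ (EFin \o alpha).
Hypothesis sigma_ge0 : {ae leb, forall t, 0 <= t -> 0 <= sigma t}.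
Hypothesis sigma_L1loc : L1_loc sigma.
Hypothesis rhom_gt0 : 0 < rhom.
Hypothesis rhop_gt0 : 0 < rhop.
Hypothesis u_gt : up < um.

Local Notation B := (Bint alpha sigma).
Local Notation X := (shock_position alpha sigma um up).
Local Notation w := (shock_weight alpha sigma rhom rhop um up).
Local Notation three := (three_states alpha sigma um up).
Local Notation potential := (potential alpha sigma rhom rhop um up).
Local Notation potential_limit := (potential_limit alpha sigma rhom rhop um up).

Let cX : continuous X. Proof. exact: shock_position_continuous. Qed.

Let B_gt0 t : B t != 0 -> 0 < B t.
Proof. by move=> h; rewrite lt_neqAle eq_sym h Bint_ge0. Qed.

Lemma measurable_potential_limit : measurable_fun setT potential_limit.
Proof.
have mfst : measurable_fun setT (fst : R * R -> R) by exact: measurable_fst.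
have mc (f : R -> R) : continuous f -> measurable_fun setT (fun p : R * R => f p.2).
  by move=> cf; apply: measurableT_comp measurable_snd; exact: continuous_measurable_fun.
have mB : measurable_fun setT (fun p : R * R => B p.2).
  by apply: mc; exact: Bint_continuous.
apply: measurable_fun_ifT.
- by apply: measurable_fun_ltr => //; exact: mc.
- by apply: measurable_funM => //; apply: measurable_funB => //; exact: measurable_funM.
- by apply: measurable_funM => //; apply: measurable_funB => //; exact: measurable_funM.
Qed.

Lemma potential_limit_bound (N : R) : exists C : R, forall p, upper p -> `|p.1| < N ->
  `|p.2| < N -> `|potential_limit p| <= C.
Proof.
exists (rhom * (N + `|um| * B N) + rhop * (N + `|up| * B N)).
move=> p p0 /ltW p1 /ltW p2; rewrite /potential_limit.
have sb (v : R) : `|p.1 - v * B p.2| <= N + `|v| * B N.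
  apply: (le_trans (ler_normB _ _)); apply: lerD => //.
  rewrite normrM ler_wpM2l// ger0_norm ?Bint_ge0//.
  by apply: Bint_homo => //; rewrite (le_trans (ler_norm _)).
have side (r v : R) : 0 < r -> `|r * (p.1 - v * B p.2)| <= r * (N + `|v| * B N).
  by move=> r0; rewrite normrM gtr0_norm// ler_pM2l.
have pos (r v : R) : 0 < r -> 0 <= r * (N + `|v| * B N).
  by move=> r0; apply: (le_trans _ (side r v r0)); exact: normr_ge0.
case: ifP => _; apply: (le_trans (side _ _ _)) => //.
  by rewrite lerDl pos.
by rewrite lerDr pos.
Qed.

Section one_test_function.
Variable phi : R * R -> R.
Hypothesis tphi : test_closed phi.

Let c_slice (f : R * R -> R) t : continuous f -> continuous (fun x => f (x, t)).
Proof.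
move=> cf x; apply: (@continuous_comp _ _ _ (fun x => (x, t)) f); last exact: cf.
by apply: continuous_pair; [exact: cvg_id|exact: cvg_cst].
Qed.

Let affine_parts (r v t : R) (x : R) :
  is_derive x 1 (fun x => r * (x - v) * phi (x, t))
    (r * phi (x, t) + r * (x - v) * dx phi (x, t)).
Proof.
have [M [M0 [cphi cx ct] [vphi vx vt] dphix _]] := test_closed_data tphi.
have := derive_mul (derive_scale r (derive_sub (derive_id_fun x) (derive_cst_fun v x)))
  (dphix x t).
by move=> /derive_eq; apply; rewrite subr0 mulr1.
Qed.

Let affine_parts_continuous (r v t : R) :
  continuous (fun x => r * phi (x, t) + r * (x - v) * dx phi (x, t)).
Proof.
have [M [M0 [cphi cx ct] _ _ _]] := test_closed_data tphi.
move=> x; apply: cvgD; first by apply: cvgM; [exact: cvg_cst|exact: c_slice].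
apply: cvgM; last exact: c_slice.
apply: cvgM; first exact: cvg_cst.
by apply: cvgB; [exact: cvg_id|exact: cvg_cst].
Qed.

(** Integration by parts in [x], the density being the derivative of the
    potential.  While [Bint] vanishes the potential has a corner at [0] but no
    jump, so no boundary term appears there either. *)
Lemma viscous_slice eps t : 0 < eps ->
  \int[leb]_x (rho_visc alpha sigma rhom rhop um up eps (x, t) * phi (x, t) +
    potential eps (x, t) * dx phi (x, t)) = 0.
Proof.
have [M [M0 [cphi cx ct] [vphi vx vt] dphix _]] := test_closed_data tphi.
move=> eps0.
have vk x : M <= `|x| -> rho_visc alpha sigma rhom rhop um up eps (x, t) * phi (x, t) +
    potential eps (x, t) * dx phi (x, t) = 0.
  by move=> xM; rewrite vphi ?vx ?mulr0 ?addr0//; left.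
have vleft x : x <= - M -> phi (x, t) = 0.
  by move=> xM; apply: vphi; left => /=; rewrite ler0_norm; lra.
have vright x : M <= x -> phi (x, t) = 0.
  by move=> xM; apply: vphi; left => /=; rewrite (le_trans xM)// ler_norm.
have [B0|/B_gt0 Bt] := eqVneq (B t) 0.
  have [] := @piecewise_FTC R _ _ _ _ (fun x => rho_visc alpha sigma rhom rhop um up eps (x, t)
      * phi (x, t) + potential eps (x, t) * dx phi (x, t)) 0 M
    (affine_parts rhom 0 t) (affine_parts rhop 0 t)
    (@affine_parts_continuous rhom 0 t) (@affine_parts_continuous rhop 0 t).
  - by move=> x xM; rewrite vleft ?mulr0.
  - by move=> x xM; rewrite vright ?mulr0.
  - by move=> x x0; rewrite rho_visc_cases// /potential /= B0 eqxx /riemann x0 subr0.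
  - move=> x x0; rewrite rho_visc_cases// /potential /= B0 eqxx /riemann.
    by rewrite ltNge (ltW x0)/= subr0.
  - exact: vk.
  by move=> _ ->; rewrite subrr !mulr0 !mul0r subrr.
pose W x := Wprofile rhom rhop um up eps x (B t).
pose r x := rho_profile rhom rhop um up eps x (B t).
have dW (x : R) : is_derive x 1 (fun x => W x * phi (x, t))
    (r x * phi (x, t) + W x * dx phi (x, t)).
  exact: derive_mul (is_derive_Wprofile rhom rhop um up eps0 Bt x) (dphix x t).
have cW : continuous W by exact: derive_continuous (is_derive_Wprofile rhom rhop um up eps0 Bt).
have cp : continuous (fun x => r x * phi (x, t) + W x * dx phi (x, t)).
  move=> x; apply: cvgD; apply: cvgM; [exact: rho_profile_continuous|exact: c_slice|
    exact: cW|exact: c_slice].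
have kE x : rho_visc alpha sigma rhom rhop um up eps (x, t) * phi (x, t) +
    potential eps (x, t) * dx phi (x, t) = r x * phi (x, t) + W x * dx phi (x, t).
  by rewrite rho_visc_cases// /potential /= gt_eqF.
have [] := @piecewise_FTC R _ _ _ _ (fun x => rho_visc alpha sigma rhom rhop um up eps (x, t)
    * phi (x, t) + potential eps (x, t) * dx phi (x, t)) 0 M dW dW cp cp.
- by move=> x xM; rewrite vleft ?mulr0.
- by move=> x xM; rewrite vright ?mulr0.
- by move=> x _; exact: kE.
- by move=> x _; exact: kE.
- exact: vk.
by move=> _ ->; rewrite subrr.
Qed.

(** The boundary term is the jump of the limit potential across the shock, and this
    jump is the weight [w]. *)
Lemma limit_slice t :
  \int[leb]_x (three rhom 0 rhop (x, t) * phi (x, t) +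
    potential_limit (x, t) * dx phi (x, t)) = - (w t * phi (X t, t)).
Proof.
have [M [M0 [cphi cx ct] [vphi vx vt] dphix _]] := test_closed_data tphi.
have [] := @piecewise_FTC R _ _ _ _ (fun x => three rhom 0 rhop (x, t) * phi (x, t) +
    potential_limit (x, t) * dx phi (x, t)) (X t) M
  (affine_parts rhom (um * B t) t) (affine_parts rhop (up * B t) t)
  (@affine_parts_continuous rhom (um * B t) t) (@affine_parts_continuous rhop (up * B t) t).
- move=> x xM; rewrite vphi ?mulr0//; left => /=; rewrite ler0_norm; lra.
- by move=> x xM; rewrite vphi ?mulr0//; left; rewrite /= (le_trans xM)// ler_norm.
- by move=> x xX; rewrite /three_states /potential_limit /= xX.
- move=> x Xx; rewrite /three_states /potential_limit /=.
  by rewrite ltNge (ltW Xx)/= gt_eqF.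
- by move=> x xM; rewrite vphi ?vx ?mulr0 ?addr0//; left.
by move=> _ ->; rewrite /shock_weight /shock_position; field.
Qed.

Lemma integrable_potential eps : 0 < eps ->
  leb2.-integrable upper (EFin \o (potential eps \* dx phi)).
Proof.
have [M [M0 [cphi cx ct] [vphi vx vt] _ _]] := test_closed_data tphi.
move=> eps0.
have [C CP] := potential_bound alpha_ge0 alpha_L1 sigma_ge0 sigma_L1loc
  rhom_gt0 rhop_gt0 u_gt eps M.
have mpot : measurable_fun upper (potential eps).
  by apply: measurable_funTS; exact: measurable_potential.
by have [] := integrable_upper_supp mpot (CP eps eps0 (lexx _)) cx vx.
Qed.

Lemma viscous_parts eps : 0 < eps ->
  int_upper (rho_visc alpha sigma rhom rhop um up eps \* phi) =
  - int_upper (potential eps \* dx phi).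
Proof.
have [M [M0 [cphi cx ct] [vphi vx vt] dphix _]] := test_closed_data tphi.
move=> eps0; apply/eqP; rewrite -addr_eq0; apply/eqP.
have [C1 C1P] := rho_visc_bound alpha_ge0 alpha_L1 sigma_ge0 sigma_L1loc
  rhom_gt0 rhop_gt0 u_gt M eps0.
have mrho : measurable_fun upper (rho_visc alpha sigma rhom rhop um up eps).
  by apply: measurable_funTS; exact: measurable_rho_visc.
have [i1 _] := integrable_upper_supp mrho
  (fun p up0 p1 p2 => C1P p up0 (ltW p1) (ltW p2)) cphi vphi.
have i2 := integrable_potential eps0.
rewrite -int_upperD// int_upper_tx; last exact: upper_integrable_add.
under eq_Rintegral do rewrite viscous_slice//.
by rewrite Rintegral_cst ?mul0r.
Qed.

Lemma limit_parts :
  - int_upper (potential_limit \* dx phi) =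
  int_upper (fun p => three rhom 0 rhop p * phi p)
  + weighted_delta `]0, +oo[ X id w phi.
Proof.
have [M [M0 [cphi cx ct] [vphi vx vt] dphix _]] := test_closed_data tphi.
have [C1 C1P] := potential_limit_bound M.
have [i1 _] := integrable_upper_supp (measurable_funTS measurable_potential_limit)
  C1P cx vx.
have m3 : measurable_fun upper (three rhom 0 rhop) by exact: measurable_three_states.
have [i2 _] := integrable_upper_supp m3
  (fun p _ _ _ => eq_ind_r (fun z => `|z| <= _) (states_bounded rhom 0 rhop _)
     (three_statesE _ _ _ _ _ _ _ p)) cphi vphi.
have : int_upper (three rhom 0 rhop \* phi) + int_upper (potential_limit \* dx phi) =
    - weighted_delta `]0, +oo[ X id w phi.
  rewrite -int_upperD// int_upper_tx; last exact: upper_integrable_add.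
  under eq_Rintegral do rewrite limit_slice -mulN1r.
  rewrite RintegralZl ?mulN1r//.
  have cw : continuous w by exact: shock_weight_continuous.
  have := curve_integrable cX 0 (locint_continuous cw) cphi vphi.
  by apply: eq_integrable_real => // t _; rewrite add0r.
by move=> E; lra.
Qed.

End one_test_function.

Lemma cvg_distr_rho :
  cvg_distr (rho_visc alpha sigma rhom rhop um up)
    (fun phi => int_upper (fun p => three rhom 0 rhop p * phi p)
                + weighted_delta `]0, +oo[ X id w phi).
Proof.
split=> [eps eps0|phi /test_open_closed[tphi _]].
  exact: locally_integrable_rho_visc.
have [M [M0 [cphi cx ct] [vphi vx vt] _ _]] := test_closed_data tphi.
have [C CP] := potential_bound alpha_ge0 alpha_L1 sigma_ge0 sigma_L1loc
  rhom_gt0 rhop_gt0 u_gt 1 M.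
have near_pos : \forall eps \near (0 : R)^'+, 0 < eps by exact: nbhs_right_gt.
apply: (@cvg_trans _ ((- int_upper (potential eps \* dx phi)) @[eps --> 0^'+])).
  apply: near_eq_cvg; apply: filterS near_pos => eps e0.
  by rewrite /regular_distr viscous_parts.
rewrite -limit_parts//; apply: cvgN.
apply: (cvg_int_upper cX _ _ CP _ cx vx).
- by move=> eps _; apply: measurable_funTS; exact: measurable_potential.
- by apply: measurable_funTS; exact: measurable_potential_limit.
- by move=> p _ pX; exact: cvg_potential.
Qed.

Lemma cvg_distr_u :
  cvg_distr (u_visc alpha sigma um up)
    (regular_distr (fun p => three um ((um + up) / 2) up p * damping sigma p.2)).
Proof.
split=> [eps eps0|phi /test_open_closed[tphi _]].
  exact: locally_integrable_u_visc.
have [M [M0 [cphi cx ct] [vphi vx vt] _ _]] := test_closed_data tphi.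
rewrite /regular_distr.
apply: (@cvg_int_upper _ _ _ _ _ M (`|um| + `|up|) cX _ _ _ _ cphi vphi).
- by move=> eps e0; apply: measurable_funTS; exact: measurable_u_visc.
- apply: measurable_funM; first exact: measurable_three_states.
  apply: measurable_funTS; apply: measurableT_comp measurable_snd.
  exact: continuous_measurable_fun (damping_continuous sigma_L1loc).
- by move=> eps e0 _ p _ _ _; exact: u_visc_bound.
- by move=> p _ pX; exact: cvg_u_visc.
Qed.

End limit_of_densities.

(** * The limit is a delta shock wave *)

Unset Implicit Arguments.
Set Strict Implicit.
Set Printing Implicit Defensive.

Theorem theorem2p2 (R : realType) (alpha sigma : R -> R)
    (rhom rhop um up : R)
    (alpha_ge0 : {ae @lebesgue_measure R, forall t, 0 <= t -> 0 <= alpha t})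
    (alpha_L1 : (@lebesgue_measure R).-integrable `[0, +oo[ (EFin \o alpha))
    (sigma_ge0 : {ae @lebesgue_measure R, forall t, 0 <= t -> 0 <= sigma t})
    (sigma_L1loc : L1_loc sigma)
    (rhom_gt0 : 0 < rhom) (rhop_gt0 : 0 < rhop) (u_gt : up < um) :
  exists (rho : (R * R -> R) -> R) (u : R * R -> R),
    [/\ cvg_distr (rho_visc alpha sigma rhom rhop um up) rho /\
        cvg_distr (u_visc alpha sigma um up) (regular_distr u),
        delta_shock_wave_solution alpha sigma
          (riemann rhom rhop) (riemann um up) rho u,
        forall phi, test_closed phi ->
          rho phi =
            int_upper (fun p =>
              three_states alpha sigma um up rhom 0 rhop p * phi p)
            + weighted_delta `]0, +oo[ (shock_position alpha sigma um up) id
                (shock_weight alpha sigma rhom rhop um up) phi &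
        forall p, upper p ->
          u p = three_states alpha sigma um up um ((um + up) / 2) up p
                * damping sigma p.2].

Proof.
pose three := three_states alpha sigma um up.
exists (fun phi => int_upper (fun p => three rhom 0 rhop p * phi p)
  + weighted_delta `]0, +oo[ (shock_position alpha sigma um up) id
      (shock_weight alpha sigma rhom rhop um up) phi).
exists (fun p => three um ((um + up) / 2) up p * damping sigma p.2).
split => //; first by split; [exact: cvg_distr_rho|exact: cvg_distr_u].
exists (delta_shock alpha sigma rhom rhop um up); split => //.
- exact: delta_shock_wf.
- exact: delta_shock_weak.
- exact: delta_shock_initial.
Qed.
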